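(* Let $0<p<1$, $q=1-p$. In the full-information problem of maximizing the duration of owning the relatively best or the second best object, with stopping allowed only at relatively best objects and with random horizon $N$ having the geometric distribution $P(N=k)=pq^{k-1}$, $k=1,2,\ldots$ (as described in the context), the one-step-look-ahead rule, which stops at the first relatively best object whose state $(n,x)$ lies in $$B=\{(n,x): w(n,x)-Tw(n,x)\ge 0\},$$ is optimal. It is a threshold strategy: it stops at the first relatively best object whose value $x$ is at least $$\frac{\mu^\star p-1}{p-1},$$ where $\mu^\star$ is the solution of the equation $\mu^2e^{2/\mu}=e^3$ with $\mu>1$. If $p\ge 1/\mu^\star$, the threshold is $0$, so the rule stops at the very first observation.
   Context: Let $X_1,X_2,\ldots$ be i.i.d. random variables uniformly distributed on $[0,1]$ and let $N$ be independent of $(X_n)$. The observation $X_n$ is available only if $N\ge n$; the decision maker observes $X_1,X_2,\ldots$ sequentially and at stage $n$ knows $X_1,\ldots,X_n$ and whether $N\ge n$ (stopping times are with respect to this information). The object $n\le N$ is relatively best if $X_n=\max\{X_1,\ldots,X_n\}$; the process is then in state $(n,x)$ with $x=X_n$. Only relatively best objects may be selected, at the moment they are observed (no recall). If the decision maker stops in state $(n,x)$, the expected payoff is $$w(n,x)=E[T_n-n\mid X_n=x]=\frac{2q}{1-qx}-\frac{q(1-q)}{(1-qx)^2},$$ which is the conditional expected duration given $N\ge n$ and $X_n=\max\{X_1,\dots,X_n\}=x$, where $T_n$ is the first moment after $n$ at which the selected object is neither the best nor the second best among the objects observed so far, or $N$ if this is smaller. If no object is selected by time $N$, the payoff is $0$.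 The objective is to maximize the expected payoff over all stopping times that stop only at relatively best objects. The expected payoff for continuing from state $(n,x)$ and stopping at the next relatively best object (if there is one up to the horizon) is $$Tw(n,x)=\sum_{m=n+1}^{\infty}\int_x^1 w(m,v)\,q^{m-n}x^{m-n-1}\,dv=\frac{q}{1-qx}\left(2\log\frac{1-qx}{1-q}+\frac{1-q}{1-qx}-1\right).$$ *)

(* Defs.v *)
From HB Require Import structures.
From mathcomp Require Import all_boot all_order all_algebra.
From mathcomp Require Import all_classical all_reals all_analysis.

Set Implicit Arguments.
Unset Strict Implicit.
Unset Printing Implicit Defensive.

Import Order.TTheory GRing.Theory Num.Theory.
Import numFieldNormedType.Exports.

Local Open Scope classical_set_scope.
Local Open Scope ring_scope.

(* Observations are numbered from 1: the term X 0 of a sequence X is never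
   used, and no hypothesis constrains it. *)

Section independence.
Context d (T : measurableType d) (R : realType) (P : probability T R).

Definition sigma_of_seq (X : nat -> {RV P >-> R}) : set (set T) :=
  <<s \bigcup_(i in [set i | (1 <= i)%N])
        preimage_set_system setT (X i) measurable >>.

Definition mutually_independent (X : nat -> {RV P >-> R}) : Prop :=
  forall (s : seq nat) (A : nat -> set R),
    uniq s -> all (leq 1) s -> (forall i, measurable (A i)) ->
    P (\big[setI/setT]_(i <- s) (X i @^-1` A i)) =
    (\prod_(i <- s) P (X i @^-1` A i))%E.

Definition independent_of_seq (X : nat -> {RV P >-> R})
    (N : {RV P >-> nat}) : Prop :=
  forall (A : set T) (K : set nat), sigma_of_seq X A ->
    P (A `&` N @^-1` K) = (P A * P (N @^-1` K))%E.

End independence.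

Section model.
Context d (T : measurableType d) (R : realType) (P : probability T R).
Variables (X : nat -> {RV P >-> R}) (N : {RV P >-> nat}).

Definition relatively_best (n : nat) (w : T) : bool :=
  X n w == \big[Num.max/X n w]_(1 <= i < n.+1) X i w.

(* At most one of the first m objects is better than object n, i.e. object n
   is the best or the second best of them. *)
Definition best_or_second (n m : nat) (w : T) : bool :=
  (\sum_(1 <= i < m.+1) (X n w < X i w)%R <= 1)%N.

(* T_n: the first m in {n+1, ..., N} at which object n is neither the best nor
   the second best of the first m objects, and N if there is none.  It is
   meaningful when n <= N. *)
Definition loss_time (n : nat) (w : T) : nat :=
  head (N w) [seq m <- iota n.+1 (N w - n) | ~~ best_or_second n m w].

Definition duration (n : nat) (w : T) : R := (loss_time n w)%:R - n%:R.

(* Information at stage n: X_1, ..., X_n and the events {N >= i}, i <= n. *)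
Definition info (n : nat) : set (set T) :=
  <<s \bigcup_(i in [set i | (1 <= i <= n)%N])
        (preimage_set_system setT (X i) measurable
         `|` [set [set w | (i <= N w)%N]]) >>.

(* A stopping rule takes the value None when no object is ever selected. *)
Definition stopping_time (tau : T -> option nat) : Prop :=
  forall n, info n [set w | tau w = Some n].

Definition admissible (tau : T -> option nat) : Prop :=
  stopping_time tau /\
  forall w n, tau w = Some n -> (1 <= n <= N w)%N /\ relatively_best n w.

Definition payoff (tau : T -> option nat) (w : T) : R :=
  if tau w is Some n then duration n w else 0.

Definition optimal (tau : T -> option nat) : Prop :=
  admissible tau /\
  forall sigma, admissible sigma ->
    (\int[P]_w (payoff sigma w)%:E <= \int[P]_w (payoff tau w)%:E)%E.

(* The rule that stops at the first relatively best object whose state lies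
   in the set S. *)
Definition first_best_in (S : set (nat * R)) (w : T) : option nat :=
  ohead [seq n <- iota 1 (N w) |
           relatively_best n w && `[< S (n, X n w) >] ].

(* u (n, .) is a version of the conditional expectation of T_n - n given
   N >= n and X_n = max (X_1, ..., X_n) = x. *)
Definition is_stopping_value (u : nat -> R -> R) : Prop :=
  forall (n : nat) (A : set R), (1 <= n)%N -> measurable A ->
    let E := [set w | [/\ (n <= N w)%N, relatively_best n w & A (X n w)]] in
    (\int[P]_(w in E) (duration n w)%:E = \int[P]_(w in E) (u n (X n w))%:E)%E.

End model.

Section one_step.
Context (R : realType).
Variable q : R.

Definition stop_value (n : nat) (x : R) : R :=
  2 * q / (1 - q * x) - q * (1 - q) / (1 - q * x) ^+ 2.

Definition next_value (n : nat) (x : R) : \bar R :=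
  (\sum_(n.+1 <= m <oo) \int[lebesgue_measure]_(v in `[x, 1%R])
     (stop_value m v * q ^+ (m - n) * x ^+ (m - n - 1))%:E)%E.

Definition osla_set : set (nat * R) :=
  [set s | [/\ (1 <= s.1)%N, 0 <= s.2 <= 1 &
     (0 <= (stop_value s.1 s.2)%:E - next_value s.1 s.2)%E]].

Definition value_at_least (c : R) : set (nat * R) := [set s | c <= s.2].

End one_step.

(* Main.v *)
Require Import Defs.
From HB Require Import structures.
From mathcomp Require Import all_boot all_order all_algebra.
From mathcomp Require Import all_classical all_reals all_analysis.
From mathcomp Require Import measurable_realfun ring lra.

Set Implicit Arguments.
Unset Strict Implicit.
Unset Printing Implicit Defensive.

Import Order.TTheory GRing.Theory Num.Theory.
Import numFieldNormedType.Exports.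
Local Open Scope classical_set_scope.
Local Open Scope ring_scope.

(** Write w for the value of stopping (it does not depend on the stage) and Tw
    for the value of continuing to the next relatively best object.  The lack of
    memory of the geometric horizon makes the problem stationary: as long as the
    process is alive, what is still to come depends on the past only through the
    current maximum.

    The engine is next_step.  On an event D that is decided by stage m and implies
    N >= m, the next observation exists with conditional probability q and is then
    uniform and independent of everything known at stage m.  So the integral of
    f (Z, X_(m+1)) over the part of D where N > m is the integral over D of
    q times the mean of f (Z, y) over y in [0, 1].  The mechanism is that, on N >= m,
    an event known at stage m coincides with an event of the sigma-algebra of
    X_1, ..., X_m, which is independent of N; then Fubini's theorem applies.

    Both probabilistic claims are obtained by telescoping such one-step identities,
    the remainder being at most a constant times P (N >= n), hence vanishing.

    - Value of stopping (integral_duration).  After object n is selected, attach to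
      it hold_value r (X_n), where r counts the later objects that beat it: w for
      r = 0, q / (1 - q x) for r = 1, and 0 once the object is lost.  This value
      equals, in conditional mean, the probability of holding the object for one more
      stage plus the hold_value after that stage.

    - Optimality (first_best_in_optimal).  Let c be the threshold, truncated at 0,
      and let Z_n = max (c, X_1, ..., X_n).  The candidate for the value of
      continuing at stage n is Tw (Z_n).  By definition of Tw it is the conditional
      mean of next_gain (Z_n, X_(n+1)), which is Tw (Z_n) if X_(n+1) < Z_n and
      w (X_(n+1)) otherwise.  This dominates what any rule gets by stopping or by
      going on at stage n + 1, because Tw <= w above the threshold and w <= Tw (c)
      below it; and the threshold rule loses nothing at any stage.  So the expected
      payoff of every rule is at most a constant that the threshold rule attains.

    With s = (1 - q x) / p, the difference w (x) - Tw (x) has the sign opposite to that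
    of 2 log s + 2 / s - 3, which is increasing for s >= 1 and vanishes exactly at
    the solution mu of the equation.  Hence w (x) >= Tw (x) if and only if s <= mu,
    that is, if and only if x is at least the threshold. *)

(** * The equation for mu *)

Section threshold_equation.
Context (R : realType).

(** The logarithm of the equation, so that the root can be located by monotonicity. *)
Definition crit (m : R) : R := 2 * ln m + 2 / m - 3.

Lemma crit_equation (m : R) : 0 < m ->
  (m ^+ 2 * expR (2 / m) = expR 3) <-> (crit m = 0).
Proof.
move=> m0.
have -> : m ^+ 2 * expR (2 / m) = expR (2 * ln m + 2 / m).
  by rewrite expRD expRM_natl lnK ?posrE.
rewrite /crit; split=> [/expR_inj ->|/subr0_eq -> //]; exact: subrr.
Qed.

(** The strict inequality log z < z - 1 for z = a / b < 1, together with
    2 / a <= 2, replaces the study of the derivative. *)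
Lemma crit_lt (a b : R) : 1 <= a -> a < b -> crit a < crit b.
Proof.
move=> a1 ab.
have a0 : 0 < a by lra.
have b0 : 0 < b by lra.
have ltl : ln (a / b) < a / b - 1.
  have h : a / b - 1 != 0.
    by rewrite subr_eq0 lt_eqF// ltr_pdivrMr// mul1r.
  rewrite -ltr_expR lnK ?posrE ?divr_gt0//.
  by have := expR_gt1Dx h; rewrite addrC subrK.
move: ltl; rewrite ln_div ?posrE// => ltl.
have e1 : 2 / a - 2 / b = 2 / a * (1 - a / b) by field; rewrite !gt_eqF.
have ab1 : 0 < 1 - a / b by rewrite subr_gt0 ltr_pdivrMr// mul1r.
have a2 : 2 / a <= 2 by rewrite ler_pdivrMr//; lra.
have : 2 / a * (1 - a / b) <= 2 * (1 - a / b) by rewrite ler_wpM2r// ltW.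
rewrite /crit; lra.
Qed.

Lemma crit_root : exists mu : R, 1 < mu /\ crit mu = 0.
Proof.
have e1 : 1 < expR 2 :> R by rewrite expR_gt1.
have cf : {within `[1, expR 2], continuous crit}.
  apply: continuous_in_subspaceT => x; rewrite inE/= in_itv/= => /andP[x1 _].
  have x0 : 0 < x by lra.
  apply: cvgB; last exact: cvg_cst.
  apply: cvgD; first by apply: cvgM; [exact: cvg_cst|exact: continuous_ln].
  by apply: cvgM; [exact: cvg_cst|apply: cvgV => //; rewrite gt_eqF].
have c1 : crit 1 = - 1 by rewrite /crit ln1 divr1; lra.
have c2 : 0 < crit (expR 2).
  have : 0 < 2 / expR 2 :> R by rewrite divr_gt0 ?expR_gt0.
  rewrite /crit expRK; lra.
have [||mu] := @IVT R crit 1 (expR 2) 0 _ cf; first exact: ltW.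
  by rewrite c1 ge_min le_max (ltW c2) oppr_le0 ler01 orbT.
rewrite in_itv/= => /andP[mu1 _] cmu; exists mu; split => //.
rewrite lt_neqAle mu1 andbT; apply/eqP => emu; move: cmu; rewrite -emu c1; lra.
Qed.

End threshold_equation.

(** * The values of stopping and of continuing *)

Section stopping_and_continuing.
Context (R : realType) (q : R) (hq : 0 < q < 1).
Implicit Types x y : R.

(** The closed form of Tw; see next_value_cont_value. *)
Definition cont_value x : R :=
  q / (1 - q * x) * (2 * ln ((1 - q * x) / (1 - q)) + (1 - q) / (1 - q * x) - 1).

Let q0 : 0 < q. Proof. by case/andP: hq. Qed.
Let q1 : 0 < 1 - q. Proof. by case/andP: hq => _; rewrite subr_gt0. Qed.

Lemma denom_ge x : x <= 1 -> 1 - q <= 1 - q * x.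
Proof. by move=> x1; rewrite lerD2l lerN2 ler_piMr// ltW. Qed.

Lemma denom_gt0 x : x <= 1 -> 0 < 1 - q * x.
Proof. by move=> /denom_ge; exact: lt_le_trans. Qed.

Lemma stop_valueE n x : x <= 1 -> stop_value q n x =
  2 * q * (1 - q * x)^-1 - q * (1 - q) * (1 - q * x)^-1 ^+ 2.
Proof. by move=> x1; rewrite /stop_value exprVn. Qed.

Lemma stop_value_ge0 n x : x <= 1 -> 0 <= stop_value q n x.
Proof.
move=> x1; rewrite stop_valueE//.
have d0 := denom_gt0 x1; have dge := denom_ge x1.
set s := (1 - q * x)^-1.
have s0 : 0 < s by rewrite invr_gt0.
have ps : (1 - q) * s <= 1 by rewrite ler_pdivrMr// mul1r.
have -> : 2 * q * s - q * (1 - q) * s ^+ 2 = q * s * (2 - (1 - q) * s) by ring.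
by rewrite mulr_ge0// ?mulr_ge0 ?ltW//; lra.
Qed.

(** In terms of s = 1 / (1 - q x) the value is q s (2 - (1 - q) s), which increases as
    long as (1 - q) s <= 1, that is, as long as x <= 1. *)
Lemma stop_value_le n x y : x <= y -> y <= 1 ->
  stop_value q n x <= stop_value q n y.
Proof.
move=> xy y1; have x1 := le_trans xy y1.
rewrite !stop_valueE//.
have dx := denom_gt0 x1; have dy := denom_gt0 y1.
have hx := denom_ge x1; have hy := denom_ge y1.
set s := (1 - q * x)^-1; set t := (1 - q * y)^-1.
have ps : (1 - q) * s <= 1 by rewrite ler_pdivrMr// mul1r.
have pt : (1 - q) * t <= 1 by rewrite ler_pdivrMr// mul1r.
have st : s <= t by rewrite lef_pV2 ?posrE// lerD2l lerN2 ler_pM2l.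
rewrite -subr_ge0.
have -> : 2 * q * t - q * (1 - q) * t ^+ 2 - (2 * q * s - q * (1 - q) * s ^+ 2)
  = q * (t - s) * (2 - ((1 - q) * s + (1 - q) * t)) by ring.
rewrite mulr_ge0//; last by lra.
by rewrite mulr_ge0 ?subr_ge0// ltW.
Qed.

Lemma stop_value_continuous n x : x <= 1 -> {for x, continuous (stop_value q n)}.
Proof.
move=> x1; have d0 := denom_gt0 x1.
have cd : {for x, continuous (fun y => 1 - q * y)}.
  by apply: cvgB; [exact: cvg_cst|apply: cvgM; [exact: cvg_cst|exact: cvg_id]].
apply: cvgB.
  by apply: cvgM; [exact: cvg_cst|apply: cvgV => //; rewrite gt_eqF].
apply: cvgM; [exact: cvg_cst|apply: cvgV; first by rewrite expf_neq0// gt_eqF].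
by apply: (@cvg_comp _ _ _ _ (fun z : R => z ^+ 2) _ _ _ cd); exact: exprn_continuous.
Qed.

Definition stop_primitive x : R := - 2 * ln (1 - q * x) - (1 - q) * (1 - q * x)^-1.

Lemma is_derive_stop_primitive n x : x <= 1 ->
  is_derive x 1 stop_primitive (stop_value q n x).
Proof.
move=> x1; have d0 := denom_gt0 x1.
have dd : is_derive x 1 (fun y => 1 - q * y) (- q).
  have -> : - q = 0 - (q *: 1 + x *: 0) :> R by rewrite scaler0 addr0 sub0r /GRing.scale/= mulr1.
  apply: is_deriveB; apply: is_deriveM.
have dl : is_derive x 1 (fun y => ln (1 - q * y)) ((1 - q * x)^-1 * - q).
  exact: (@is_derive1_comp _ (@ln R) (fun y => 1 - q * y) _ _ _ (is_derive1_ln d0) dd).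
have dv : is_derive x 1 (fun y => (1 - q * y)^-1) (- (1 - q * x) ^- 2 *: - q).
  by apply: is_deriveV => //; rewrite gt_eqF.
apply: is_derive_eq.
rewrite /GRing.scale/= /stop_value; field.
by rewrite gt_eqF.
Qed.

Lemma integral_stop_value n x : x <= 1 ->
  (\int[lebesgue_measure]_(v in `[x, 1%R]) (stop_value q n v)%:E)%E =
  (2 * ln ((1 - q * x) / (1 - q)) + (1 - q) / (1 - q * x) - 1)%:E.
Proof.
rewrite le_eqVlt => /predU1P[->|x1].
  rewrite set_itv1 integral_set1 mulr1 divff ?gt_eqF// ln1; congr EFin; ring.
have d0 := denom_gt0 (ltW x1).
rewrite (@continuous_FTC2 _ _ stop_primitive)//.
- rewrite -EFinB /stop_primitive mulr1 ln_div ?posrE// mulfV ?gt_eqF//.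
  by congr EFin; ring.
- apply: continuous_in_subspaceT => y; rewrite inE/= in_itv/= => /andP[_].
  exact: stop_value_continuous.
- have dP y : y <= 1 -> {for y, continuous stop_primitive}.
    move=> y1; apply: differentiable_continuous; apply/derivable1_diffP.
    by have [] := is_derive_stop_primitive 0 y1.
  split.
  + move=> y; rewrite in_itv/= => /andP[_ /ltW y1].
    by have [] := is_derive_stop_primitive 0 y1.
  + by apply: cvg_at_right_filter; apply: dP; exact: ltW.
  + by apply: cvg_at_left_filter; exact: dP.
- move=> y; rewrite in_itv/= => /andP[_ /ltW y1].
  by rewrite derive1E; have [_ ->] := is_derive_stop_primitive n y1.
Qed.

Lemma cont_value_ge0 x : x <= 1 -> 0 <= cont_value x.
Proof.
move=> x1; rewrite /cont_value mulr_ge0//.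
  by rewrite divr_ge0 ?ltW// denom_gt0.
rewrite -lee_fin -(integral_stop_value 0 x1); apply: integral_ge0 => v /=.
by rewrite in_itv/= lee_fin => /andP[_]; exact: stop_value_ge0.
Qed.

Lemma cont_value_le x : 0 <= x <= 1 ->
  cont_value x <= q / (1 - q) * (2 * ln (1 - q)^-1).
Proof.
move=> /andP[x0 x1]; rewrite /cont_value.
have d0 := denom_gt0 x1; have dge := denom_ge x1.
have d1 : 1 - q * x <= 1 by rewrite gerBl mulr_ge0// ltW.
have l0 : 0 <= ln (1 - q)^-1 by rewrite ln_ge0// invr_ge1 ?unitf_gt0//; lra.
have l1 : ln ((1 - q * x) / (1 - q)) <= ln (1 - q)^-1.
  by rewrite ler_ln ?posrE ?divr_gt0 ?invr_gt0// ler_piMl// invr_ge0 ltW.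
have r1 : (1 - q) / (1 - q * x) <= 1 by rewrite ler_pdivrMr// mul1r.
apply: (@le_trans _ _ (q / (1 - q * x) * (2 * ln (1 - q)^-1))).
  rewrite ler_wpM2l//; last by lra.
  by rewrite divr_ge0 ?ltW.
by rewrite ler_wpM2r ?mulr_ge0// ler_pM2l// lef_pV2 ?posrE.
Qed.

(** The inverse is continuous away from 0; its value at 0 is a convention, and
    {0} is measurable. *)
Lemma measurable_invr : measurable_fun setT (@GRing.inv R).
Proof.
rewrite -(setUv [set (0 : R)]); apply/measurable_funU => //.
  exact: measurableC.
split; first exact: measurable_fun_set1.
apply: open_continuous_measurable_fun; first exact/closed_openC/accessible_closed_set1/hausdorff_accessible/Rhausdorff.
by move=> x /set_mem /eqP x0; exact: inv_continuous.
Qed.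

Lemma measurable_denom : measurable_fun setT (fun x => (1 - q * x)^-1).
Proof.
apply: (measurableT_comp measurable_invr).
by apply: measurable_funB => //; exact: measurable_funM.
Qed.

Lemma measurable_stop_value n : measurable_fun setT (stop_value q n).
Proof.
rewrite (_ : stop_value q n = fun x =>
  2 * q * (1 - q * x)^-1 - q * (1 - q) * (1 - q * x)^-1 ^+ 2); last first.
  by apply/funext => x; rewrite /stop_value exprVn.
have md := measurable_denom.
apply: measurable_funB; apply: measurable_funM => //.
exact: measurable_funX.
Qed.

Lemma measurable_cont_value : measurable_fun setT cont_value.
Proof.
have md := measurable_denom.
apply: measurable_funM; first exact: measurable_funM.
apply: measurable_funB => //; apply: measurable_funD; apply: measurable_funM => //.
apply: (measurableT_comp (@measurable_ln R)); apply: measurable_funM => //.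
by apply: measurable_funB => //; exact: measurable_funM.
Qed.

(** The m-th term is the integral of w over [x, 1] times q^(m-n) x^(m-n-1), so the
    series is geometric with ratio q x. *)
Lemma next_value_cont_value n x : 0 <= x <= 1 ->
  next_value q n x = (cont_value x)%:E.
Proof.
move=> /andP[x0 x1].
set W := 2 * ln ((1 - q * x) / (1 - q)) + (1 - q) / (1 - q * x) - 1.
have W0 : 0 <= W.
  rewrite -lee_fin -(integral_stop_value 0 x1); apply: integral_ge0 => v /=.
  by rewrite in_itv/= lee_fin => /andP[_]; exact: stop_value_ge0.
have termE m : (\int[lebesgue_measure]_(v in `[x, 1%R])
     (stop_value q m v * q ^+ (m - n) * x ^+ (m - n - 1))%:E =
     (W * q ^+ (m - n) * x ^+ (m - n - 1))%:E)%E.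
  under eq_integral do rewrite -mulrA EFinM.
  rewrite ge0_integralZr//.
  - by rewrite integral_stop_value// -EFinM mulrA.
  - apply/measurable_EFinP; apply: measurable_funTS; exact: measurable_stop_value.
  - by move=> v /=; rewrite in_itv/= lee_fin => /andP[_]; exact: stop_value_ge0.
  - by rewrite lee_fin mulr_ge0 ?exprn_ge0// ltW.
rewrite /next_value (eq_eseriesr (fun m _ => termE m)) -nneseries_addn; last first.
  by move=> m; rewrite lee_fin !mulr_ge0 ?exprn_ge0// ltW.
have qx1 : `|q * x| < 1.
  rewrite ger0_norm ?mulr_ge0// ?ltW//; have /andP[_] := hq; apply: le_lt_trans.
  by rewrite ler_piMr// ltW.
apply/cvg_lim => //; have := @cvg_geometric_series _ (W * q) _ qx1.
rewrite (_ : W * q / (1 - q * x) = cont_value x); last first.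
  by rewrite /cont_value -/W; ring.
move=> cvW; rewrite (_ : (fun _ => _) = EFin \o series (geometric (W * q) (q * x))).
  by apply: cvg_EFin => //; exact: nearW.
apply/funext => k /=; rewrite /series/= -sumEFin; apply: eq_bigr => i _.
congr EFin; rewrite addnS subSn ?leq_addl// addnK subn1/= exprS exprMn; ring.
Qed.

(** This reduces the comparison of w and Tw to the sign of crit. *)
Lemma stop_sub_cont n x : x <= 1 ->
  stop_value q n x - cont_value x =
  - (q / (1 - q * x)) * crit ((1 - q * x) / (1 - q)).
Proof.
move=> x1; have d0 := denom_gt0 x1.
by rewrite /stop_value /cont_value /crit; field; rewrite !gt_eqF.
Qed.

Definition threshold mu : R := (mu * (1 - q) - 1) / (1 - q - 1).

Section threshold_rule.
Context (mu : R) (mu1 : 1 < mu) (mu_root : crit mu = 0).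

Local Notation thr := (threshold mu).

Lemma ratio_ge1 x : x <= 1 -> 1 <= (1 - q * x) / (1 - q).
Proof. by move=> x1; rewrite ler_pdivlMr// mul1r denom_ge. Qed.

(** The change of variable s = (1 - q x) / (1 - q) turns the threshold into the root
    mu of crit. *)
Lemma ratio_thr : (1 - q * thr) / (1 - q) = mu.
Proof. 
have qN : - q != 0 by rewrite oppr_eq0 gt_eqF.
have -> : thr = (mu * (1 - q) - 1) / - q by rewrite /threshold; congr (_ / _); ring.
by field; rewrite !gt_eqF. Qed.

Lemma thr_lt1 : thr < 1.
Proof.
have : mu * (1 - q) > 1 - q by rewrite ltr_pMl.
have -> : thr = (1 - mu * (1 - q)) / q.
  rewrite /threshold (_ : 1 - q - 1 = - q); last ring.
  by field; rewrite gt_eqF.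
by rewrite ltr_pdivrMr// mul1r; lra.
Qed.

Lemma cont_le_stopP n x : 0 <= x <= 1 ->
  (cont_value x <= stop_value q n x) = (thr <= x).
Proof.
move=> /andP[x0 x1]; have d0 := denom_gt0 x1.
rewrite -subr_ge0 stop_sub_cont// mulNr oppr_ge0 pmulr_rle0 ?divr_gt0//.
have -> : (thr <= x) = ((1 - q * x) / (1 - q) <= mu).
  by rewrite -[in RHS]ratio_thr ler_pM2r ?invr_gt0// lerD2l lerN2 ler_pM2l.
apply/idP/idP => [|h].
  by apply: contraTT; rewrite -!ltNge -mu_root; apply: crit_lt; exact: ltW.
rewrite -mu_root; move: h; rewrite le_eqVlt => /predU1P[->//|h].
by apply/ltW/crit_lt => //; exact: ratio_ge1.
Qed.

(** At the threshold w and Tw agree, and w increases: below the threshold it is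
    better to wait for an observation above it than to stop. *)
Lemma stop_le_cont_thr n x : x < thr -> stop_value q n x <= cont_value thr.
Proof.
move=> xt; have t1 := ltW thr_lt1.
apply: (le_trans (stop_value_le n (ltW xt) t1)).
by rewrite -subr_le0 stop_sub_cont// ratio_thr mu_root mulr0.
Qed.

Lemma osla_setE n x : (1 <= n)%N -> 0 <= x <= 1 ->
  osla_set q (n, x) <-> thr <= x.
Proof.
move=> n1 x01; rewrite -(cont_le_stopP n x01) /osla_set/=.
rewrite next_value_cont_value// -EFinB lee_fin subr_ge0.
by split=> [[]//|].
Qed.

End threshold_rule.

(** Mean gain when a uniform observation below z is ignored, leaving the value a, and
    one above z yields g. *)
Lemma integral_unit_below (g : R -> R) a z : 0 <= z <= 1 -> 0 <= a ->
  measurable_fun setT g -> (forall v, v <= 1 -> 0 <= g v) ->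
  (\int[lebesgue_measure]_(v in `[0%R, 1%R]) (if v < z then a else g v)%:E =
   (z * a)%:E + \int[lebesgue_measure]_(v in `[z, 1%R]) (g v)%:E)%E.
Proof.
move=> /andP[z0 z1] a0 mg g0.
have -> : `[0%R, 1%R]%classic = `[0%R, z[%classic `|` `[z, 1%R]%classic.
  by rewrite -itv_bndbnd_setU// bnd_simp.
rewrite ge0_integral_setU//.
- congr (_ + _)%E.
    rewrite (eq_integral (fun=> a%:E)); last first.
      by move=> v; rewrite inE/= in_itv/= => /andP[_ ->].
    rewrite integral_cst//= lebesgue_measure_itv/= lte_fin mulrC EFinM.
    by case: ltP => [_|z0']; rewrite ?oppr0 ?adde0//; have -> : z = 0 by apply/le_anti; rewrite z0 z0'.
  by apply: eq_integral => v; rewrite inE/= in_itv/= => /andP[zv _]; rewrite ltNge zv.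
- apply/measurable_EFinP/measurable_funTS; apply: measurable_fun_ifT => //.
  exact: measurable_fun_ltr.
- by move=> v [|] /=; rewrite in_itv/= lee_fin => /andP[_ v1]; case: ifP => // _; apply: g0;
   rewrite ?(le_trans (ltW v1)).
- apply/disj_setPS => v [] /=; rewrite !in_itv/= => /andP[_ vz] /andP[zv _].
  by move: zv; rewrite leNgt vz.
Qed.

Lemma integral_unit_above (a b z : R) : 0 <= z <= 1 -> 0 <= a -> 0 <= b ->
  (\int[lebesgue_measure]_(v in `[0%R, 1%R]) (if (z < v)%R then b else a)%:E =
   (z * a + (1 - z) * b)%:E)%E.
Proof.
move=> /andP[z0 z1] a0 b0.
have -> : `[0%R, 1%R]%classic = `[0%R, z]%classic `|` `]z, 1%R]%classic.
  by rewrite -itv_bndbnd_setU// bnd_simp.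
rewrite ge0_integral_setU//.
- rewrite EFinD; congr (_ + _)%E.
    rewrite (eq_integral (fun=> a%:E)); last first.
      by move=> v; rewrite inE/= in_itv/= => /andP[_ vz]; rewrite ltNge vz.
    rewrite integral_cst//= lebesgue_measure_itv/= lte_fin mulrC EFinM.
    by case: ltP => [_|z0']; rewrite ?oppr0 ?adde0//; have -> : z = 0 by apply/le_anti; rewrite z0 z0'.
  rewrite (eq_integral (fun=> b%:E)); last first.
    by move=> v; rewrite inE/= in_itv/= => /andP[zv _]; rewrite zv.
  rewrite integral_cst//= lebesgue_measure_itv/= lte_fin mulrC EFinM.
  case: ltP => [_//|h]; have -> : z = 1 by apply/le_anti; rewrite z1.
  by rewrite subrr.
- apply/measurable_EFinP/measurable_funTS; apply: measurable_fun_ifT => //.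
  exact: measurable_fun_ltr.
- by move=> v _; rewrite lee_fin; case: ifP.
- apply/disj_setPS => v [] /=; rewrite !in_itv/= => /andP[_ vz] /andP[zv _].
  by move: zv; rewrite ltNge vz.
Qed.

End stopping_and_continuing.

(** * Telescoping series and first indices *)

Lemma nneseries_finite (R : realType) (f : nat -> \bar R) L :
  (forall k, (L <= k)%N -> f k = 0%E) ->
  (\sum_(0 <= k <oo) f k = \sum_(0 <= k < L) f k)%E.
Proof.
move=> f0; apply: lim_near_cst => //; exists L => // K /= LK.
rewrite (@big_cat_nat _ _ _ L)//=.
have -> : (\sum_(L <= k < K) f k = 0)%E; last by rewrite adde0.
by rewrite big_nat_cond big1// => k; rewrite andbT => /andP[/f0].
Qed.

Lemma telescope_le (R : realType) (a x : nat -> \bar R) :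
  (forall k, 0 <= a k)%E -> (forall k, 0 <= x k)%E ->
  (forall k, x k + a k.+1 <= a k)%E ->
  (\sum_(0 <= k <oo) x k <= a 0%N)%E.
Proof.
move=> a0 x0 xa; apply: lime_le; first exact: is_cvg_nneseries.
apply: nearW => K.
suff : (\sum_(0 <= k < K) x k + a K <= a 0%N)%E by apply: le_trans; rewrite leeDl.
elim: K => [|K IH]; first by rewrite big_nil add0e.
by rewrite big_nat_recr//= -addeA; apply: le_trans IH; rewrite leeD2l.
Qed.

(** The geometric bound makes the remainder a K of the partial sums vanish. *)
Lemma telescope_eq (R : realType) (a x : nat -> \bar R) (C q : R) :
  0 < q < 1 ->
  (forall k, 0 <= a k)%E -> (forall k, 0 <= x k)%E ->
  (forall k, x k + a k.+1 = a k)%E -> (forall k, a k <= (C * q ^+ k)%:E)%E ->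
  (\sum_(0 <= k <oo) x k = a 0%N)%E.
Proof.
move=> /andP[q0 q1] a0 x0 xa aC; apply/le_anti.
rewrite telescope_le//=; last by move=> k; rewrite xa.
have partial K : (\sum_(0 <= k < K) x k + a K = a 0%N)%E.
  elim: K => [|K IH]; first by rewrite big_nil add0e.
  by rewrite big_nat_recr//= -addeA xa.
apply/lee_addgt0Pr => e e0.
have : (fun k => C * q ^+ k) @ \oo --> (0 : R).
  by apply: cvg_geometric; rewrite gtr0_norm.
move=> /cvgrPdist_lt /(_ _ e0)[K _ /(_ K (leqnn K))].
rewrite sub0r normrN => /ltW CK.
rewrite -(partial K) leeD//; first exact: nneseries_lim_ge.
by apply: (le_trans (aC K)); rewrite lee_fin; apply: le_trans CK; exact: ler_norm.
Qed.

(** This is the loss time: b m says that the object is still held at time m, and the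
    default n + L of head is the horizon. *)
Lemma head_first_failure (b : nat -> bool) L n :
  (forall m, b m.+1 -> b m) -> b n ->
  head (n + L)%N [seq m <- iota n.+1 L | ~~ b m] =
  (n + \sum_(0 <= k < L) b (n + k))%N.
Proof.
move=> bS; elim: L n => [|L IH] n bn; first by rewrite big_nil.
rewrite big_nat_recl//= addn0 bn addnA addn1.
case: ifPn => [nb|/negbNE bSn].
  rewrite big1_seq ?addn0// => k _; apply/eqP; rewrite eqb0.
  elim: k => [|k]; first by rewrite addn1.
  by apply: contra => /=; rewrite addnS => /bS.
rewrite -addSnnS IH//; congr addn; apply: eq_bigr => k _.
by rewrite addSnnS.
Qed.

Lemma ohead_filter_iotaP (p : pred nat) s L n :
  ohead [seq m <- iota s L | p m] = Some n <->
  [/\ (s <= n < s + L)%N, p n & forall m, (s <= m < n)%N -> ~~ p m].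
Proof.
elim: L s => [|L IH] s /=.
  by split=> // -[]; rewrite addn0 => /andP[sn] /(leq_ltn_trans sn); rewrite ltnn.
case: ifPn => ps /=.
  split=> [[<-]|[/andP[sn _] pn nm]].
    split=> //; first by rewrite leqnn /= -addSnnS leq_addr.
    by move=> m /andP[sm] /(leq_ltn_trans sm); rewrite ltnn.
  congr Some; apply/eqP; rewrite eqn_leq sn/= leqNgt; apply/negP => ns.
  by have := nm s; rewrite leqnn ns ps => /(_ isT).
rewrite IH addSnnS; split=> -[/andP[sn nL] pn nm].
  split=> //; first by rewrite (ltnW sn).
  move=> m /andP[]; rewrite leq_eqVlt => /predU1P[<- //|sm mn].
  by apply: nm; rewrite sm.
split=> //; last by move=> m /andP[/ltnW sm mn]; apply: nm; rewrite sm.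
rewrite nL andbT ltn_neqAle sn andbT; apply: contra ps => /eqP ->.
exact: pn.
Qed.

(** * Complements of measure theory *)

Lemma measurable_fun_nat_index d d' (S : measurableType d)
    (S' : measurableType d') (F : nat -> S -> S') (nu : S -> nat) :
  measurable_fun setT nu -> (forall r, measurable_fun setT (F r)) ->
  measurable_fun setT (fun s => F (nu s) s).
Proof.
move=> mnu mF _ B mB; rewrite setTI.
rewrite (_ : _ @^-1` B = \bigcup_r (nu @^-1` [set r] `&` F r @^-1` B)).
  apply: bigcupT_measurable => r; apply: measurableI.
    by rewrite -[X in measurable X]setTI; exact: mnu.
  by rewrite -[X in measurable X]setTI; exact: mF.
apply/seteqP; split=> [s Bs|s [r _ [<-]]//].
by exists (nu s).
Qed.

Lemma measurable_bigcap_nat d (T : measurableType d) (D : set nat)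
    (F : nat -> set T) :
  (forall i, D i -> measurable (F i)) -> measurable (\bigcap_(i in D) F i).
Proof.
move=> mF; rewrite -[X in measurable X]setCK setC_bigcap; apply: measurableC.
by apply: bigcup_measurable => i Di; apply: measurableC; exact: mF.
Qed.

(** Off D the restricted measure vanishes, and on subsets of D both measures agree. *)
Lemma ge0_integral_mrestr d (T : measurableType d) (R : realType)
    (mu : {measure set T -> \bar R}) (D : set T) (mD : measurable D)
    (f : T -> \bar R) :
  measurable_fun setT f -> (forall x, 0 <= f x)%E ->
  (\int[mrestr mu mD]_x f x = \int[mu]_(x in D) f x)%E.
Proof.
move=> mf f0; transitivity (\int[mrestr mu mD]_(x in D) f x)%E.
  rewrite -(setUv D) ge0_integral_setU//; first last.
  - by apply/disj_setPS; rewrite setICr.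
  - by rewrite setUv.
  - exact: measurableC.
  rewrite [X in (_ + X)%E]null_set_integral ?adde0//.
  - exact: measurableC.
  - exact: measurable_funTS.
  - by rewrite /= /mrestr setICl measure0.
by apply: eq_measure_integral => A mA AD; rewrite /= /mrestr setIidl.
Qed.

(** * Independence of the past, the next observation and the horizon *)

Section observations.
Context d (T : measurableType d) (R : realType) (P : probability T R).
Context (X : nat -> {RV P >-> R}) (N : {RV P >-> nat}) (q : R).
Context (hq : 0 < q < 1).
Context (X_unif : forall (i : nat) (A : set R), (1 <= i)%N -> measurable A ->
       distribution P (X i) A = uniform_prob (@ltr01 R) A).
Context (X_indep : mutually_independent X) (N_indep : independent_of_seq X N).
Context (N_geom : forall k : nat, (1 <= k)%N ->
       P (N @^-1` [set k]) = ((1 - q) * q ^+ k.-1)%:E).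

Let q0 : 0 < q. Proof. by case/andP: hq. Qed.
Let q1 : 0 < 1 - q. Proof. by case/andP: hq => _; rewrite subr_gt0. Qed.

Definition alive n : set T := [set w | (n <= N w)%N].

Lemma measurable_alive n : measurable (alive n).
Proof.
by have /(_ [set k | (n <= k)%N]) := measurable_funP N measurableT; rewrite setTI; exact.
Qed.

Lemma alive_prob n : (1 <= n)%N -> P (alive n) = (q ^+ n.-1)%:E.
Proof.
move=> n1.
have mN k : measurable (N @^-1` [set k]).
  by have /(_ [set k]) := measurable_funP N measurableT; rewrite setTI; exact.
have -> : alive n = \bigcup_j (N @^-1` [set (n + j)%N]).
  apply/seteqP; split=> [w nw|w [j _ jw]]; last by rewrite /alive/= jw leq_addr.
  by exists (N w - n)%N => //=; rewrite subnKC.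
rewrite measure_semi_bigcup//; last 2 first.
  apply/trivIsetP => i j _ _ ij; apply/seteqP; split => // w [/= -> /eqP].
  by rewrite eqn_add2l (negbTE ij).
  exact: bigcupT_measurable.
have nj j : (n + j).-1 = (n.-1 + j)%N by case: n n1.
rewrite (eq_eseriesr (fun j _ => N_geom (leq_trans n1 (leq_addr j n)))).
have nq1 : `|q| < 1 by rewrite ger0_norm ?(ltW q0)//; case/andP: hq.
have := @cvg_geometric_series _ ((1 - q) * q ^+ n.-1) _ nq1.
rewrite mulrAC mulfV ?gt_eqF// mul1r => cvq; apply/cvg_lim => //.
rewrite (_ : (fun _ => _) = EFin \o series (geometric ((1 - q) * q ^+ n.-1) q)).
  by apply: cvg_EFin => //; exact: nearW.
apply/funext => k /=; rewrite /series/= -sumEFin; apply: eq_bigr => i _.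
by rewrite nj exprD mulrA.
Qed.

(** The events that depend on X_1, ..., X_n only, without information on N. *)
Definition past n : set (set T) :=
  <<s \bigcup_(i in [set i | (1 <= i <= n)%N])
        preimage_set_system setT (X i) measurable >>.

Lemma past_sub_sigma_of_seq n : past n `<=` sigma_of_seq X.
Proof.
apply: sub_smallest2r; first exact: smallest_sigma_algebra.
by move=> A [i /= /andP[i1 _] AX]; exists i.
Qed.

Lemma sigma_of_seq_preimage i B : (1 <= i)%N -> measurable B ->
  sigma_of_seq X (X i @^-1` B).
Proof.
move=> i1 mB; apply: sub_gen_smallest; exists i => //=.
by exists B => //; rewrite setTI.
Qed.

Lemma past_preimage n i B : (1 <= i <= n)%N -> measurable B ->
  past n (X i @^-1` B).
Proof.
move=> i1 mB; apply: sub_gen_smallest; exists i => //=.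
by exists B => //; rewrite setTI.
Qed.

Lemma measurable_preimage i B : measurable B -> measurable (X i @^-1` B).
Proof. by move=> mB; rewrite -[X in measurable X]setTI; exact: measurable_funP. Qed.

Let cylinder n : set (set T) := [set A | exists F : nat -> set R,
  (forall i, measurable (F i)) /\ A = \big[setI/setT]_(i <- iota 1 n) X i @^-1` F i].

Let past_sub_cylinder n : past n `<=` <<s cylinder n >>.
Proof.
apply: smallest_sub; first exact: smallest_sigma_algebra.
move=> _ [i /= i1n [B mB <-]]; apply: sub_gen_smallest.
exists (fun j => if j == i then B else setT); split=> [j|]; first by case: ifP.
rewrite setTI (big_rem i) ?mem_iota ?add1n ?ltnS//= eqxx big1_seq ?setIT// => j.
rewrite andTb mem_rem_uniq ?iota_uniq// inE => /andP[/negbTE -> _].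
by rewrite preimage_setT.
Qed.

(** Finite independence gives the product formula on cylinders, which are stable by
    intersection and generate the past; the events that satisfy it form a Dynkin
    system. *)
Lemma past_next_indep n A B : past n A -> measurable B ->
  P (A `&` X n.+1 @^-1` B) = (P A * P (X n.+1 @^-1` B))%E.
Proof.
move=> /past_sub_cylinder + mB.
set Y := X n.+1 @^-1` B; have mY : measurable Y by exact: measurable_preimage.
suff: <<s cylinder n >> `<=`
    [set A | measurable A /\ P (A `&` Y) = (P A * P Y)%E] by move=> h /h[].
have PYfin : P Y \is a fin_num by rewrite fin_num_measure.
apply: lambda_system_subset => //.
- move=> _ _ [F [mF ->]] [G [mG ->]].
  exists (fun i => F i `&` G i); split; first by move=> i; exact: measurableI.
  rewrite -big_split/=; apply: eq_bigr => i _; exact: preimage_setI.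
- apply/dynkin_lambda_system; split.
  + by split => //; rewrite setTI probability_setT mul1e.
  + move=> C [mC PC]; split; first exact: measurableC.
    have -> : ~` C `&` Y = Y `\` (C `&` Y).
      by rewrite setDIr setDv setU0 setDE setIC.
    rewrite measureD//; last 2 first.
    * exact: measurableI.
    * by rewrite (le_lt_trans (probability_le1 _ _))// ltry.
    transitivity (P Y - P (C `&` Y))%E; first by rewrite [Y `&` _]setIC -setIA setIid.
    rewrite PC probability_setC// muleBl ?mul1e//.
  + move=> F tF mF; split; first by apply: bigcupT_measurable => k; case: (mF k).
    rewrite setI_bigcupl !measure_semi_bigcup//.
    * rewrite -(fineK PYfin) muleC -nneseriesZl//; apply: eq_eseriesr => i _.
      by rewrite muleC fineK//; case: (mF i).
    * by move=> i; case: (mF i).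
    * by apply: bigcupT_measurable => k; case: (mF k).
    * by move=> i; apply: measurableI => //; case: (mF i).
    * apply/trivIsetP => i j _ _ ij; rewrite setIACA setIid.
      by move/trivIsetP : tF => /(_ i j Logic.I Logic.I ij) ->; rewrite set0I.
    * by apply: bigcupT_measurable => k; apply: measurableI => //; case: (mF k).
- move=> _ [F [mF ->]]; split.
    by apply: bigsetI_measurable => i _; exact: measurable_preimage.
  pose G i := if i == n.+1 then B else F i.
  have FG i : i \in iota 1 n -> G i = F i.
    by rewrite mem_iota add1n ltnS /G => /andP[_]; case: eqP => // ->; rewrite ltnn.
  have mG i : measurable (G i) by rewrite /G; case: ifP.
  have iotaS : iota 1 n.+1 = rcons (iota 1 n) n.+1.
    by rewrite -cats1 -[n.+1 in LHS]addn1 iotaD add1n.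
  have all1 k : all (leq 1) (iota 1 k).
    by apply/allP => i; rewrite mem_iota => /andP[].
  have := X_indep (iota_uniq 1 n.+1) (all1 n.+1) mG.
  rewrite iotaS !big_rcons/= [G n.+1]/G eqxx => e.
  rewrite (X_indep (iota_uniq 1 n) (all1 n) mF).
  rewrite (eq_big_seq (fun i => P (X i @^-1` G i))); last by move=> i /FG ->.
  rewrite -[RHS]e; congr (P (_ `&` _)).
  by apply: eq_big_seq => i /FG ->.
Qed.

(** Naming the generators of info gives a measurable space (state_space below), in
    which being known at stage n is measurability in the usual sense. *)
Definition info_gen n : set (set T) :=
  \bigcup_(i in [set i | (1 <= i <= n)%N])
     (preimage_set_system setT (X i) measurable
         `|` [set [set w | (i <= N w)%N]]).

Lemma info_preimage n i B : (1 <= i <= n)%N -> measurable B ->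
  info X N n (X i @^-1` B).
Proof.
move=> i1 mB; apply: sub_gen_smallest; exists i => //=; left.
by exists B => //; rewrite setTI.
Qed.

Lemma info_alive n i : (1 <= i <= n)%N -> info X N n (alive i).
Proof. by move=> i1; apply: sub_gen_smallest; exists i => //=; right. Qed.

Lemma info_measurable n A : info X N n A -> measurable A.
Proof.
move: A; apply: smallest_sub; first exact: sigma_algebra_measurable.
move=> _ [i _ [[B mB <-]|->]]; last exact: measurable_alive.
by rewrite setTI; exact: measurable_preimage.
Qed.

Lemma info_sub m n : (m <= n)%N -> info X N m `<=` info X N n.
Proof.
move=> mn; apply: sub_smallest2r; first exact: smallest_sigma_algebra.
move=> A [i /= /andP[i1 im] ?]; exists i => //=.
by rewrite i1 (leq_trans im).
Qed.

(** On N >= n each event N >= i with i <= n becomes the whole space, so that only the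
    information carried by the observations remains. *)
Lemma info_trace n A : info X N n A ->
  exists2 A', past n A' & A `&` alive n = A' `&` alive n.
Proof.
move: A; apply: smallest_sub.
  split.
  - by exists set0 => //; exact: sigma_algebra0.
  - move=> A [A' pA' e]; exists (~` A'); first exact: sigma_algebraC.
    rewrite setTD; apply/seteqP; split => w [nA aw]; split => // Aw; apply: nA.
      by have [] : (A `&` alive n) w by rewrite e.
    by have [] : (A' `&` alive n) w by rewrite -e.
  - move=> F /(_ _)/cid2-/all_sig2[G pG e].
    exists (\bigcup_k G k); first exact: sigma_algebra_bigcup.
    by rewrite !setI_bigcupl; apply: eq_bigcupr => i _.
move=> _ [i /= i1n [[B mB <-]|->]].
  by exists (X i @^-1` B); [exact: past_preimage|rewrite setTI].
exists setT; first exact: (@measurableT _ (g_sigma_algebraType _)).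
rewrite setTI setIidr// => w /=; apply: leq_trans.
by case/andP: i1n.
Qed.

Lemma alive_indep A n : sigma_of_seq X A -> (1 <= n)%N ->
  P (A `&` alive n) = (P A * (q ^+ n.-1)%:E)%E.
Proof.
move=> sA n1; rewrite -(alive_prob n1).
exact: (N_indep [set k | (n <= k)%N] sA).
Qed.

(** On D the event is one of the past, which is independent of N and of the next
    observation; the factor q is P (N >= m + 1) / P (N >= m). *)
Lemma next_observation_indep m D B : (1 <= m)%N -> info X N m D ->
  D `<=` alive m -> measurable B ->
  P (D `&` alive m.+1 `&` X m.+1 @^-1` B) =
  (q%:E * P D * distribution P (X m.+1) B)%E.
Proof.
move=> m1 iD Dm mB; have [A pA] := info_trace iD.
rewrite (setIidl Dm) => DA.
have am : alive m.+1 `<=` alive m by move=> w; exact: ltnW.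
rewrite DA -(setIA A) (setIidr am) setIAC alive_indep//; last first.
  apply: (@measurableI _ (g_sigma_algebraType _)).
    exact: past_sub_sigma_of_seq pA.
  exact: sigma_of_seq_preimage.
rewrite past_next_indep// alive_indep//; last exact: past_sub_sigma_of_seq pA.
rewrite -[P (X m.+1 @^-1` B)]/(distribution P (X m.+1) B).
rewrite -[in (q ^+ _)](prednK m1) exprS EFinM.
by rewrite muleAC [in RHS]muleCA.
Qed.

Lemma observation_unit i : (1 <= i)%N -> {ae P, forall w, 0 <= X i w <= 1}.
Proof.
move=> i1; exists (X i @^-1` (~` `[0, 1]%classic)); split.
- by apply: measurable_preimage; exact: measurableC.
- rewrite -[LHS]/(distribution P (X i) _) X_unif//; last exact: measurableC.
  rewrite /uniform_prob integral_uniform_pdf setICl integral_set0//.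
- by move=> w /=; rewrite in_itv.
Qed.

(** The law of an observation lives on R with its default measurable structure, the
    uniform law on the one generated by the half-open intervals; the identity map
    transports one to the other. *)
Lemma integral_next_observation i (h : R -> \bar R) : (1 <= i)%N ->
  measurable_fun setT h -> (forall y, 0 <= h y)%E ->
  (\int[distribution P (X i)]_y h y =
   \int[lebesgue_measure]_(y in `[0%R, 1%R]) h y)%E.
Proof.
move=> i1 mh h0.
rewrite -[RHS]mul1e -[X in (X%:E * _)%E]invr1 -[X in (X^-1%:E * _)%E]subr0.
rewrite -(integral_uniform ltr01 mh h0).
pose idTR : measurableTypeR R -> R := idfun.
have midTR : measurable_fun setT idTR by move=> _ A mA; rewrite setTI.
rewrite -[RHS](@ge0_integral_pushforward _ _ _ _ _ idTR midTR (uniform_prob (@ltr01 R)) setT h)//.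
apply: eq_measure_integral => A mA _.
exact: X_unif.
Qed.

(** The joint law of (Z, X_(m+1)) on the part of D where N > m is a product measure, by
    next_observation_indep on rectangles; Fubini's theorem then integrates out
    X_(m+1).  The set Q holds the almost sure values of Z, so that f needs to be
    controlled only on Q times [0, 1]. *)
Lemma next_step d' (T' : measurableType d') (m : nat) (D : set T)
    (Z : T -> T') (Q : set T') (f : T' * R -> R) (g : T' -> R) :
  (1 <= m)%N -> info X N m D -> D `<=` alive m ->
  (forall B, measurable B -> info X N m (Z @^-1` B)) ->
  measurable_fun setT f -> measurable_fun setT g ->
  {ae P, forall w, Q (Z w)} ->
  (forall z (y : R), Q z -> 0 <= y <= 1 -> 0 <= f (z, y)) ->
  (forall z, Q z ->
    (q%:E * \int[lebesgue_measure]_(y in `[0%R, 1%R]) (f (z, y))%:E =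
     (g z)%:E)%E) ->
  (\int[P]_(w in D `&` alive m.+1) (f (Z w, X m.+1 w))%:E =
   \int[P]_(w in D) (g (Z w))%:E)%E.
Proof.
move=> m1 iD Dm iZ mf mg QZ f0 fg.
have mD : measurable D := info_measurable iD.
have mE : measurable (D `&` alive m.+1).
  by apply: measurableI => //; exact: measurable_alive.
have mZ : measurable_fun setT Z.
  by move=> _ B mB; rewrite setTI; exact: info_measurable (iZ _ mB).
have mh : measurable_fun setT (fun w => (Z w, X m.+1 w)).
  exact: measurable_fun_pair.
(* The positive part of f agrees with f almost surely and suits Tonelli's theorem. *)
pose fp z := Num.max (f z) 0.
have mfp : measurable_fun setT (EFin \o fp).
  by apply/measurable_EFinP; exact: measurable_maxr.
have fp0 z : (0 <= (EFin \o fp) z)%E by rewrite lee_fin le_max lexx orbT.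
pose U := distribution P (X m.+1).
pose F z := (\int[U]_y (fp (z, y))%:E)%E.
have q_ge0 : 0 <= q by exact: ltW.
pose nuD := mscale (NngNum q_ge0) (mrestr P mD).
pose m1' := pushforward nuD Z.
have m1fin : fin_num_fun (m1' : set T' -> \bar R).
  move=> A mA; rewrite /m1' /pushforward fin_num_measure//.
  by rewrite -[X in measurable X]setTI; exact: mZ.
(* m1' is q times the law of Z on D; the product measure requires its finiteness. *)
pose M1 : {finite_measure set T' -> \bar R} := HB.pack (m1' : set T' -> \bar R)
  (measure_function_pushforward__canonical__measure_function_Measure nuD mZ)
  (Measure_isFinite.Build _ _ _ _ m1fin).
have intF : (\int[P]_(w in D `&` alive m.+1) (fp (Z w, X m.+1 w))%:E =
    \int[P]_(w in D) (q%:E * F (Z w)))%E.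
  have mfph : measurable_fun setT (EFin \o fp \o (fun w => (Z w, X m.+1 w))).
    exact: measurableT_comp mfp mh.
  rewrite -(ge0_integral_mrestr P mE mfph (fun w => fp0 _)).
  rewrite -[LHS](@ge0_integral_pushforward _ _ _ _ _ _ mh (mrestr P mE) setT (EFin \o fp))//.
  transitivity (\int[M1 \x U]_z (EFin \o fp) z)%E.
    pose nuE := measure_function_pushforward__canonical__measure_function_Measure
      (mrestr P mE) mh.
    apply: (@eq_measure_integral _ _ _ setT (M1 \x U)%E nuE) => A mA _.
    apply/esym/product_measure_unique => // B C mB mC.
    rewrite /= /m1' /pushforward /nuD /mscale/= /mrestr.
    rewrite -next_observation_indep//.
    - by congr (P _); apply/seteqP; split => w [] [] => [? ? []|[]].
    - by apply: (@measurableI _ (g_sigma_algebraType _)) => //; exact: iZ.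
    - by move=> w [_ /Dm].
  rewrite fubini_tonelli1//.
  have mF : measurable_fun setT F.
    exact: (@measurable_fun_fubini_tonelli_F _ _ _ _ _ U (EFin \o fp)).
  have F0 z : (0 <= F z)%E by apply: integral_ge0 => y _; exact: (fp0 (z, y)).
  rewrite [LHS](@ge0_integral_pushforward _ _ _ _ _ _ mZ nuD setT F)//.
  have mFZ : measurable_fun setT (F \o Z) by exact: measurableT_comp mF mZ.
  transitivity (q%:E * \int[mrestr P mD]_w (F \o Z) w)%E.
    by rewrite preimage_setT; apply: ge0_integral_mscale => // w _; exact: F0.
  rewrite ge0_integralZl//; last exact: measurable_funTS.
  congr (_ * _)%E.
  by apply: (ge0_integral_mrestr P mD mFZ) => w; exact: F0.
transitivity (\int[P]_(w in D `&` alive m.+1) (fp (Z w, X m.+1 w))%:E)%E.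
  apply: ae_eq_integral => //.
  - by apply/measurable_funTS/measurable_EFinP; exact: measurableT_comp mf mh.
  - by apply/measurable_funTS; exact: measurableT_comp mfp mh.
  - have X01 := @observation_unit m.+1 isT.
    apply: filterS2 QZ X01 => w Qw Xw _.
    by congr EFin; rewrite /fp max_l// f0.
rewrite intF; apply: ae_eq_integral => //.
- apply: measurable_funeM; apply/measurable_funTS; apply: (measurableT_comp _ mZ).
  exact: (@measurable_fun_fubini_tonelli_F _ _ _ _ _ U (EFin \o fp)).
- by apply/measurable_funTS/measurable_EFinP; exact: measurableT_comp mg mZ.
- apply: filterS QZ => w Qw _; rewrite /F integral_next_observation//; first last.
  - by move=> y; exact: (fp0 (Z w, y)).
  - by apply: (measurableT_comp mfp); exact: measurable_fun_pair.
  have fpf : (\int[lebesgue_measure]_(y in `[0%R, 1%R]) (fp (Z w, y))%:E =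
      \int[lebesgue_measure]_(y in `[0%R, 1%R]) (f (Z w, y))%:E)%E.
    apply: eq_integral => y; rewrite inE/= in_itv/= => y01.
    by rewrite /fp max_l// f0.
  by rewrite fpf; exact: fg.
Qed.

(** * The expected duration of a selected object *)

Local Notation state_space m := (g_sigma_algebraType (info_gen m)).

Lemma info_measurable_fun m d' (T' : measurableType d') (Z : T -> T') :
  measurable_fun (setT : set (state_space m)) Z ->
  forall B, measurable B -> info X N m (Z @^-1` B).
Proof. by move=> mZ B mB; have := mZ measurableT B mB; rewrite setTI. Qed.

Lemma measurable_fun_info m d' (T' : measurableType d') (Z : T -> T') :
  measurable_fun (setT : set (state_space m)) Z -> measurable_fun setT Z.
Proof.
move=> mZ _ B mB; rewrite setTI; apply: info_measurable.
exact: info_measurable_fun mZ _ mB.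
Qed.

Lemma observation_info m i : (1 <= i <= m)%N ->
  measurable_fun (setT : set (state_space m)) (X i).
Proof. by move=> im _ B mB; rewrite setTI; exact: info_preimage. Qed.

Definition rank n m w : nat := \sum_(1 <= i < m.+1) (X n w < X i w)%R.

Lemma rankS n m w : rank n m.+1 w = (rank n m w + (X n w < X m.+1 w)%R)%N.
Proof. by rewrite /rank big_nat_recr. Qed.

Lemma rank_info n m k : (1 <= n <= m)%N -> (k <= m)%N ->
  measurable_fun (setT : set (state_space m)) (rank n k).
Proof.
move=> nm; elim: k => [_|k IH km].
  rewrite (_ : rank n 0 = fun=> 0%N)//.
  by apply/funext => w; rewrite /rank big_geq.
rewrite (_ : rank n k.+1 = fun w => (rank n k w + (X n w < X k.+1 w)%R)%N).
  apply: measurable_fun_addn; first by apply: IH; exact: ltnW.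
  rewrite (_ : (fun w => nat_of_bool _) =
    fun w => if X n w < X k.+1 w then 1%N else 0%N)//.
  apply: measurable_fun_ifT => //.
  by apply: measurable_fun_ltr; apply: observation_info.
by apply/funext => w; exact: rankS.
Qed.

Lemma relatively_bestP n w :
  reflect (forall i, (1 <= i <= n)%N -> X i w <= X n w) (relatively_best X n w).
Proof.
apply: (iffP eqP) => [-> i|h].
  rewrite -ltnS => i1n; apply: (le_bigmax_seq (X n w) i xpredT (fun i => X i w)) => //.
  by rewrite mem_index_iota.
apply/le_anti/andP; split; first exact: bigmax_ge_id.
rewrite big_seq; apply: bigmax_le => // i; rewrite mem_index_iota ltnS.
exact: h.
Qed.

Lemma relatively_best_rank n w : relatively_best X n w = (rank n n w == 0%N).
Proof.
rewrite /rank; apply/relatively_bestP/idP => [h|].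
  rewrite big_nat_cond big1// => i; rewrite andbT ltnS => /h.
  by rewrite leNgt => /negbTE ->.
rewrite sum_nat_seq_eq0 => /allP h i i1n.
have := h i; rewrite mem_index_iota ltnS => /(_ i1n)/=.
by rewrite eqb0 -leNgt.
Qed.

Lemma relatively_best_info n m : (1 <= n <= m)%N ->
  info X N m [set w | relatively_best X n w].
Proof.
move=> /[dup] nm /andP[_ n_m].
rewrite (_ : [set w | _] = rank n n @^-1` [set 0%N]).
  exact: (info_measurable_fun (rank_info nm n_m)).
apply/seteqP; split => w /=; rewrite relatively_best_rank; first by move/eqP.
by move=> ->.
Qed.

(** T_n - n counts the stages n + k + 1 <= N such that the object was still best or
    second best at stage n + k. *)
Lemma duration_series n w : (n <= N w)%N -> relatively_best X n w ->
  ((duration X N n w)%:E =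
   \sum_(0 <= k <oo) (\1_(alive (n + k).+1 `&` [set w | (rank n (n + k) w <= 1)%N])
     w)%:E :> \bar R)%E.
Proof.
move=> nN; rewrite relatively_best_rank => /eqP r0.
rewrite (@nneseries_finite _ _ (N w - n)); last first.
  move=> k; rewrite leq_subLR => Nk; rewrite indicE memNset// => -[] /=.
  by rewrite /alive/= ltnNge Nk.
rewrite /duration /loss_time -{1}(subnKC nN).
rewrite (head_first_failure (b := fun m => best_or_second X n m w)); last 2 first.
- by move=> m; rewrite /best_or_second -!/(rank _ _ _) rankS; apply: leq_trans; exact: leq_addr.
- by rewrite /best_or_second -/(rank _ _ _) r0.
rewrite natrD addrAC subrr add0r natr_sum -sumEFin; apply: eq_big_nat => k /andP[_ kN].
congr EFin; rewrite indicE; congr (_%:R); congr nat_of_bool.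
have kw : (n + k < N w)%N by rewrite -ltn_subRL.
by apply/idP/idP; rewrite ?inE /alive/=; [move=> ?; split|case].
Qed.

(** Observations exceed 1 with probability 0 only; truncating them makes w and Tw
    nonnegative everywhere, so that all integrals below are integrals of
    nonnegative functions. *)
Definition clip (x : R) : R := Num.min x 1.

Lemma clip_le1 x : clip x <= 1. Proof. by rewrite ge_min lexx orbT. Qed.

Lemma clip_id x : x <= 1 -> clip x = x. Proof. by move=> ?; rewrite /clip min_l. Qed.

Lemma measurable_clip : measurable_fun setT clip.
Proof. exact: measurable_minr. Qed.

Definition stop_clip x := stop_value q 0 (clip x).

Lemma stop_clip_ge0 x : 0 <= stop_clip x.
Proof. by apply: stop_value_ge0 => //; exact: clip_le1. Qed.

Lemma measurable_stop_clip : measurable_fun setT stop_clip.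
Proof. by apply: measurableT_comp measurable_clip; exact: measurable_stop_value. Qed.

Lemma stop_clip_le x : stop_clip x <= q / (1 - q).
Proof.
apply: (le_trans (stop_value_le hq 0 (clip_le1 x) (lexx 1))).
rewrite le_eqVlt; apply/orP; left; apply/eqP; rewrite /stop_value; field.
by rewrite gt_eqF.
Qed.

(** Expected remaining duration of an object of value x that has been beaten r times. *)
Definition hold_value (r : nat) (x : R) : R :=
  if r == 0%N then stop_clip x
  else if r == 1%N then q / (1 - q * clip x) else 0.

Lemma hold_value_ge0 r x : 0 <= hold_value r x.
Proof.
rewrite /hold_value; case: ifP => _; first exact: stop_clip_ge0.
by case: ifP => // _; rewrite divr_ge0 ?ltW// denom_gt0 ?clip_le1.
Qed.

Lemma hold_value_le r x : hold_value r x <= q / (1 - q).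
Proof.
rewrite /hold_value; case: ifP => _; first exact: stop_clip_le.
have qq : 0 <= q / (1 - q) by rewrite divr_ge0// ltW.
case: ifP => // _; rewrite ler_pM2l// lef_pV2 ?posrE ?denom_gt0 ?clip_le1//.
by rewrite denom_ge ?clip_le1.
Qed.

(** One step of the horizon: with probability q there is a next stage, which counts
    if the object was not yet lost, and the new observation beats it with
    probability 1 - x. *)
Lemma hold_value_rec r x : 0 <= x <= 1 ->
  q * ((r <= 1)%N%:R + (x * hold_value r x + (1 - x) * hold_value r.+1 x)) =
  hold_value r x.
Proof.
move=> /andP[x0 x1]; have := denom_gt0 hq x1.
case: r => [|[|r]]; rewrite /hold_value/= /stop_clip ?clip_id// /stop_value => d0.
- by field; rewrite gt_eqF.
- by field; rewrite gt_eqF.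
- by ring.
Qed.

Lemma measurable_hold_value r : measurable_fun setT (hold_value r).
Proof.
rewrite /hold_value; case: eqP => _; first exact: measurable_stop_clip.
case: eqP => _ //; apply: measurable_funM => //.
by apply: (measurableT_comp (measurable_denom q)); exact: measurable_clip.
Qed.

Lemma alive_bound n k C (A : set T) (h : T -> R) : (1 <= n)%N ->
  measurable A -> A `<=` alive (n + k) -> measurable_fun setT h ->
  (forall w, 0 <= h w <= C) ->
  (\int[P]_(w in A) (h w)%:E <= (C * q ^+ n.-1 * q ^+ k)%:E)%E.
Proof.
move=> n1 mA Ank mh hC.
have C0 : 0 <= C by have /andP[] := hC point; exact: le_trans.
apply: (@le_trans _ _ (\int[P]_(w in A) C%:E)%E).
  apply: ge0_le_integral => //.
  - by move=> w _; rewrite lee_fin; case/andP: (hC w).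
  - by apply/measurable_EFinP; exact: measurable_funTS.
  - by move=> w _; rewrite lee_fin; case/andP: (hC w).
rewrite integral_cst// -mulrA EFinM lee_wpmul2l ?lee_fin//.
rewrite -exprD (_ : (n.-1 + k)%N = (n + k).-1); last by case: n n1 {Ank}.
rewrite -alive_prob ?(leq_trans n1) ?leq_addr//.
by apply: le_measure => //; rewrite inE//; exact: measurable_alive.
Qed.

(** The integral a k of the hold_value at stage n + k over the part of E where
    N >= n + k decreases at each stage by the probability of holding the object for
    one more stage, by next_step.  These decrements sum to the expected duration, and
    the initial term a 0 is the integral of w. *)
Lemma integral_duration n E : (1 <= n)%N -> info X N n E ->
  E `<=` [set w | (n <= N w)%N /\ relatively_best X n w] ->
  measurable_fun E (fun w => (duration X N n w)%:E) /\
  (\int[P]_(w in E) (duration X N n w)%:E =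
   \int[P]_(w in E) (stop_clip (X n w))%:E)%E.
Proof.
move=> n1 iE Ebest.
have mE : measurable E := info_measurable iE.
have En : E `<=` alive n by move=> w /Ebest[].
pose D k := E `&` alive (n + k).
have iD k : info X N (n + k) (D k).
  apply: (@measurableI _ (state_space (n + k))).
    exact: (info_sub (leq_addr _ _) iE).
  by apply: info_alive; rewrite leqnn andbT (leq_trans n1)// leq_addr.
have mD k : measurable (D k) := info_measurable (iD k).
have nk k : (1 <= n <= n + k)%N by rewrite n1 leq_addr.
have mrank k : measurable_fun setT (rank n (n + k)).
  by apply: (@measurable_fun_info (n + k)); exact: rank_info.
pose B k := alive (n + k).+1 `&` [set w | (rank n (n + k) w <= 1)%N].
have mB k : measurable (B k).
  apply: measurableI; first exact: measurable_alive.
  by have := mrank k measurableT [set r | (r <= 1)%N] I; rewrite setTI.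
have durE : {in E, forall w, (duration X N n w)%:E =
    (\sum_(0 <= k <oo) (\1_(B k) w)%:E)%E}.
  by move=> w /[1!inE] /Ebest[nw bw]; rewrite duration_series.
have m1B k : measurable_fun E (fun w => (\1_(B k) w)%:E : \bar R).
  by apply/measurable_funTS/measurable_EFinP; exact: measurable_indic.
split.
  apply: (eq_measurable_fun (fun w => \sum_(0 <= k <oo) (\1_(B k) w)%:E)%E).
    by move=> w wE; rewrite durE.
  by apply: ge0_emeasurable_sum => // k w _ _; rewrite lee_fin.
have mhold k : measurable_fun setT (fun w => hold_value (rank n (n + k) w) (X n w)).
  apply: (@measurable_fun_nat_index _ _ _ _ (fun r w => hold_value r (X n w))) => //.
  by move=> r; apply: measurableT_comp => //; exact: measurable_hold_value.
pose a k := (\int[P]_(w in D k) (hold_value (rank n (n + k) w) (X n w))%:E)%E.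
pose x k := P (B k `&` E).
have step k : (x k + a k.+1 = a k)%E.
  pose Z w := (rank n (n + k) w, X n w).
  (* The state is the pair of the rank and of the selected value; the observation
     raises the rank when it is larger. *)
  pose f (z : nat * R * R) : R := (z.1.1 <= 1)%N%:R +
    (if z.1.2 < z.2 then hold_value z.1.1.+1 z.1.2 else hold_value z.1.1 z.1.2).
  pose g (z : nat * R) := hold_value z.1 z.2.
  have mr : measurable_fun setT (fun z : nat * R * R => z.1.1).
    by apply: measurableT_comp.
  have mx : measurable_fun setT (fun z : nat * R * R => z.1.2).
    by apply: measurableT_comp.
  have mf : measurable_fun setT f.
    apply: (@measurable_fun_nat_index _ _ (nat * R * R)%type R
      (fun r z => (r <= 1)%N%:R + (if z.1.2 < z.2 then hold_value r.+1 z.1.2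
        else hold_value r z.1.2)) _ mr) => r.
    apply: measurable_funD => //; apply: measurable_fun_ifT.
    - exact: measurable_fun_ltr.
    - by apply: (measurableT_comp (measurable_hold_value _)).
    - by apply: (measurableT_comp (measurable_hold_value _)).
  have mg : measurable_fun setT g.
    apply: (@measurable_fun_nat_index _ _ (nat * R)%type R (fun r z => hold_value r z.2)) => // r.
    by apply: (measurableT_comp (measurable_hold_value _)).
  have iZ : forall A, measurable A -> info X N (n + k) (Z @^-1` A).
    apply: info_measurable_fun; apply: measurable_fun_pair.
      exact: rank_info.
    exact: observation_info.
  have f0 z y : 0 <= f (z, y).
    by rewrite /f addr_ge0//; case: ifP => _; exact: hold_value_ge0.
  have X01 := observation_unit n1.
  have := @next_step _ _ (n + k) (D k) Z [set z | 0 <= z.2 <= 1] f g.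
  move=> /(_ (leq_trans n1 (leq_addr _ _)) (iD k) (@subIsetr _ _ _) iZ mf mg X01).
  move=> /(_ (fun z y _ _ => f0 z y)) H.
  rewrite /a -[RHS]H; last first.
    move=> [r z] /= z01; have /andP[z0 z1] := z01.
    rewrite /g/= -(hold_value_rec r z01) /f/=.
    under eq_integral do rewrite (fun_if (+%R _)).
    rewrite integral_unit_above ?addr_ge0 ?hold_value_ge0// -EFinM; congr EFin.
    by rewrite -/(hold_value r.+1 z); ring.
  have -> : D k `&` alive (n + k).+1 = D k.+1.
    by rewrite /D addnS -setIA (setIidr (_ : alive (n + k).+1 `<=` _))// => w; exact: ltnW.
  rewrite [RHS](eq_integral (fun w => (\1_([set w | (rank n (n + k) w <= 1)%N]) w)%:E +
      (hold_value (rank n (n + k.+1) w) (X n w))%:E)%E); last first.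
    move=> w _; rewrite /f/= addnS rankS indicE; congr (_ + _)%:E.
      by congr (nat_of_bool _)%:R; apply/idP/idP; rewrite inE.
    by case: ifP => _; rewrite ?addn0 ?addn1.
  have mr1 : measurable [set w | (rank n (n + k) w <= 1)%N].
    by have := mrank k measurableT [set r | (r <= 1)%N] I; rewrite setTI.
  rewrite ge0_integralD//.
  - rewrite integral_indic//; congr (P _ + _)%E.
    by rewrite /B /D addnS [RHS]setIC -setIA [RHS]setIC setIC setIA.
  - by apply/measurable_funTS/measurable_EFinP; exact: measurable_indic.
  - by move=> w _; rewrite lee_fin hold_value_ge0.
  - by apply/measurable_EFinP/measurable_funTS.
rewrite (eq_integral (fun w => (\sum_(0 <= k <oo) (\1_(B k) w)%:E)%E)); last first.
  by move=> w wE; rewrite durE.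
rewrite integral_nneseries//.
rewrite (eq_eseriesr (g := x)); last by move=> k _; rewrite integral_indic.
rewrite (@telescope_eq _ a x (q / (1 - q) * q ^+ n.-1) q hq)//.
- rewrite /a /D addn0 (setIidl En); apply: eq_integral => w /[1!inE] /Ebest[_].
  by rewrite relatively_best_rank => /eqP ->.
- by move=> k; apply: integral_ge0 => w _; rewrite lee_fin hold_value_ge0.
- move=> k; apply: alive_bound => //; first by move=> w [].
  by move=> w; rewrite hold_value_ge0 hold_value_le.
Qed.

Lemma stop_clip_ae n m : (1 <= n)%N ->
  {ae P, forall w, stop_clip (X n w) = stop_value q m (X n w)}.
Proof.
move=> n1; apply: filterS (observation_unit n1) => w /andP[_ x1].
by rewrite /stop_clip clip_id.
Qed.

Lemma stop_value_correct : is_stopping_value X N (stop_value q).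
Proof.
move=> n A n1 mA E.
have iE : info X N n E.
  rewrite (_ : E = alive n `&` [set w | relatively_best X n w] `&` X n @^-1` A).
    apply: (@measurableI _ (state_space n)).
      apply: (@measurableI _ (state_space n)).
        by apply: info_alive; rewrite n1 leqnn.
      by apply: relatively_best_info; rewrite n1 leqnn.
    by apply: info_preimage; rewrite ?n1 ?leqnn.
  by apply/seteqP; split => [w []//|w [[]]].
have [_ ->] := integral_duration n1 iE (fun w Ew => let: And3 a b _ := Ew in conj a b).
apply: ae_eq_integral.
- exact: info_measurable iE.
- apply/measurable_funTS/measurable_EFinP; apply: measurableT_comp => //.
  exact: measurable_stop_clip.
- apply/measurable_funTS/measurable_EFinP; apply: measurableT_comp => //.
  exact: measurable_stop_value.
- by apply: filterS (stop_clip_ae n n1) => w + _ => ->.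
Qed.

(** * Optimality of the threshold rule *)

Section optimality.
Context (mu : R) (mu1 : 1 < mu) (mu_root : crit mu = 0).
Local Notation thr := (threshold q mu).

(** Both the state from which the maximum starts and the level below which nothing is
    selected; it is the threshold when that is positive, and 0 otherwise. *)
Definition start_level : R := Num.max 0 thr.

Let start01 : 0 <= start_level <= 1.
Proof. by rewrite le_max lexx/= ge_max ler01 ltW// thr_lt1. Qed.

(** The maximum of the level c and of the first n observations.  Waiting below c or
    below the current maximum has the same effect, so this is the only state
    variable that is needed. *)
Fixpoint peak n (w : T) : R :=
  if n is m.+1 then Num.max (peak m w) (X m.+1 w) else start_level.

Definition in_unit (w : T) := forall i, (1 <= i)%N -> 0 <= X i w <= 1.

Lemma in_unit_ae : {ae P, forall w, in_unit w}.
Proof.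
apply: ae_foralln => -[|n]; first by apply: nearW.
by apply: filterS (observation_unit (ltn0Sn n)) => w Xw _.
Qed.

Lemma peak_info m n : (n <= m)%N ->
  measurable_fun (setT : set (state_space m)) (peak n).
Proof.
elim: n => [_|n IH nm] //=; apply: measurable_maxr; first by apply: IH; exact: ltnW.
exact: observation_info.
Qed.

Lemma peak_unit n w : in_unit w -> 0 <= peak n w <= 1.
Proof.
move=> Uw; elim: n => [//|n /andP[p0 p1]] /=.
by rewrite le_max p0/= ge_max p1; have /andP[] := Uw n.+1 isT.
Qed.

Lemma peak_ge_start n w : start_level <= peak n w.
Proof. by elim: n => [//|n IH] /=; rewrite le_max IH. Qed.

Lemma peak_ge n w i : (1 <= i <= n)%N -> X i w <= peak n w.
Proof.
elim: n => [|n IH] /=; first by case: i.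
case/andP=> i1; rewrite leq_eqVlt => /predU1P[->|i_n].
  by rewrite le_max lexx orbT.
by rewrite le_max IH// i1.
Qed.

Lemma peak_cases n w :
  peak n w = start_level \/ exists2 i, (1 <= i <= n)%N & peak n w = X i w.
Proof.
elim: n => [|n IH] /=; first by left.
case: (leP (peak n w)) => _; first by right; exists n.+1; rewrite ?leqnn.
case: IH => [->|[i /andP[i1 i_n] ->]]; first by left.
by right; exists i => //; rewrite i1 leqW.
Qed.

Definition cont_clip z := cont_value q (clip z).

Lemma cont_clip_ge0 z : 0 <= cont_clip z.
Proof. by apply: cont_value_ge0 => //; exact: clip_le1. Qed.

Lemma measurable_cont_clip : measurable_fun setT cont_clip.
Proof. by apply: measurableT_comp measurable_clip; exact: measurable_cont_value. Qed.

(** Gain at the next stage, in state z, when the observation is v and the threshold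
    rule is followed: below z nothing is selected and the state remains z. *)
Definition next_gain (z v : R) : R := if v < z then cont_clip z else stop_clip v.

Lemma next_gain_ge0 z v : 0 <= next_gain z v.
Proof. by rewrite /next_gain; case: ifP => _; rewrite ?cont_clip_ge0 ?stop_clip_ge0. Qed.

Lemma measurable_next_gain :
  measurable_fun setT (fun zv : R * R => next_gain zv.1 zv.2).
Proof.
apply: measurable_fun_ifT.
- exact: measurable_fun_ltr.
- by apply: (measurableT_comp measurable_cont_clip).
- by apply: (measurableT_comp measurable_stop_clip).
Qed.

(** The fixed-point equation q (z Tw(z) + integral of w over [z, 1]) = Tw(z). *)
Lemma mean_next_gain z : 0 <= z <= 1 ->
  (q%:E * \int[lebesgue_measure]_(v in `[0%R, 1%R]) (next_gain z v)%:E =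
   (cont_clip z)%:E)%E.
Proof.
move=> /[dup] z01 /andP[z0 z1]; rewrite /next_gain.
rewrite (integral_unit_below (g := stop_clip)) ?cont_clip_ge0//; last 2 first.
- exact: measurable_stop_clip.
- by move=> v _; exact: stop_clip_ge0.
have -> : (\int[lebesgue_measure]_(v in `[z, 1%R]) (stop_clip v)%:E =
    \int[lebesgue_measure]_(v in `[z, 1%R]) (stop_value q 0 v)%:E)%E.
  apply: eq_integral => v; rewrite inE/= in_itv/= => /andP[_ v1].
  by rewrite /stop_clip clip_id.
rewrite integral_stop_value// -EFinD -EFinM; congr EFin.
have d0 := denom_gt0 hq z1.
rewrite /cont_clip clip_id// /cont_value; field.
by rewrite !gt_eqF.
Qed.

(** A relatively best observation that is below the state is below the threshold, and
    there stopping is worth at most Tw at the threshold. *)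
Lemma stop_le_next_gain n w : in_unit w -> relatively_best X n.+1 w ->
  stop_clip (X n.+1 w) <= next_gain (peak n w) (X n.+1 w).
Proof.
move=> Uw /relatively_bestP best; rewrite /next_gain; case: ltP => // Xpeak.
have /andP[X0 X1] := Uw n.+1 isT.
have peakE : peak n w = start_level.
  case: (peak_cases n w) => [//|[i /andP[i1 i_n] pE]].
  by move: Xpeak; rewrite pE ltNge best// i1 leqW.
have startE : start_level = thr.
  move: Xpeak; rewrite peakE /start_level; have [//|_] := leP 0 thr.
  by rewrite ltNge X0.
move: Xpeak; rewrite peakE startE => Xthr.
rewrite /stop_clip /cont_clip !clip_id//; last exact/ltW/thr_lt1.
exact: stop_le_cont_thr.
Qed.

(** If the observation reaches the state, it becomes the new state and lies above the
    threshold, where Tw <= w. *)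
Lemma cont_le_next_gain n w : in_unit w ->
  cont_clip (peak n.+1 w) <= next_gain (peak n w) (X n.+1 w).
Proof.
move=> Uw; rewrite /next_gain /=; case: ltP => // peakX.
have /andP[X0 X1] := Uw n.+1 isT.
rewrite /stop_clip /cont_clip !clip_id// (cont_le_stopP hq mu1 mu_root)//; last first.
  by rewrite X0.
by apply: le_trans peakX; apply: le_trans (peak_ge_start n w); rewrite le_max lexx orbT.
Qed.

Lemma stop_eq_next_gain n w : in_unit w -> relatively_best X n.+1 w ->
  thr <= X n.+1 w ->
  next_gain (peak n w) (X n.+1 w) = stop_clip (X n.+1 w).
Proof.
move=> Uw /relatively_bestP best thrX; rewrite /next_gain ltNge.
have /andP[X0 _] := Uw n.+1 isT.
suff -> : peak n w <= X n.+1 w by [].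
case: (peak_cases n w) => [->|[i /andP[i1 i_n] ->]]; first by rewrite ge_max X0.
by apply: best; rewrite i1 leqW.
Qed.

Lemma cont_eq_next_gain n w :
  ~ (relatively_best X n.+1 w /\ thr <= X n.+1 w) ->
  next_gain (peak n w) (X n.+1 w) = cont_clip (peak n.+1 w).
Proof.
move=> nstop; rewrite /next_gain /=; case: ltP => // peakX.
exfalso; apply: nstop; split.
  apply/relatively_bestP => i /andP[i1]; rewrite leq_eqVlt => /predU1P[->//|i_n].
  by apply: le_trans peakX; apply: peak_ge; rewrite i1.
by apply: le_trans peakX; apply: le_trans (peak_ge_start n w); rewrite le_max lexx orbT.
Qed.

Section rule.
Context (sigma : T -> option nat) (adm : admissible X N sigma).

Definition stops n : set T := [set w | sigma w = Some n].
(** Alive at stage n, with nothing selected up to that stage. *)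
Definition waiting n : set T :=
  alive n `&` \bigcap_(i in [set i | (i <= n)%N]) ~` stops i.

Lemma stops_measurable n : measurable (stops n).
Proof. by have [st _] := adm; exact: info_measurable (st n). Qed.

Lemma waiting_measurable n : measurable (waiting n).
Proof.
apply: measurableI; first exact: measurable_alive.
by apply: measurable_bigcap_nat => i _; apply: measurableC; exact: stops_measurable.
Qed.

Lemma waiting_info n : (1 <= n)%N -> info X N n (waiting n).
Proof.
move=> n1; apply: (@measurableI _ (state_space n)).
  by apply: info_alive; rewrite n1 leqnn.
apply: (@measurable_bigcap_nat _ (state_space n)) => i /= i_n.
apply: (@measurableC _ (state_space n)); have [st _] := adm.
exact: info_sub (st i).
Qed.

Lemma waiting_next n : waiting n `&` alive n.+1 = stops n.+1 `|` waiting n.+1.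
Proof.
apply/seteqP; split => w.
  move=> [[_ nst] an]; have [st|nst1] := EM (sigma w = Some n.+1); first by left.
  right; split=> // i /=; rewrite leq_eqVlt => /predU1P[->//|]; exact: nst.
move=> [st|[an nst]].
  have [_ /(_ _ _ st)[/andP[_ nN] _]] := adm.
  split=> //; split; first by rewrite /alive/= ltnW.
  by move=> i /= i_n; rewrite /stops/= st => -[e]; move: i_n; rewrite -e ltnn.
split=> //; split; first by rewrite /alive/= ltnW.
by move=> i /= i_n; apply: nst; rewrite /= leqW.
Qed.

(** Candidate for the expected payoff still to be collected from the situation of
    having selected nothing up to stage n.  It is written before taking the
    conditional mean over X_(n+1), so that it makes sense at n = 0 too, where it does
    not depend on the rule. *)
Definition future n : \bar R :=
  (\int[P]_(w in waiting n `&` alive n.+1) (next_gain (peak n w) (X n.+1 w))%:E)%E.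

Definition stopped_gain n : \bar R :=
  (\int[P]_(w in stops n) (stop_clip (X n w))%:E)%E.

Let m_gain n : measurable_fun setT (fun w => (next_gain (peak n w) (X n.+1 w))%:E).
Proof.
apply/measurable_EFinP.
have mpX : measurable_fun setT (fun w => (peak n w, X n.+1 w)).
  apply: measurable_fun_pair => //.
  exact: (measurable_fun_info (peak_info (leqnn n))).
exact: (measurableT_comp measurable_next_gain mpX).
Qed.

Let m_stop n : measurable_fun setT (fun w => (stop_clip (X n w))%:E).
Proof.
by apply/measurable_EFinP; apply: (measurableT_comp measurable_stop_clip).
Qed.

Let m_cont n : measurable_fun setT (fun w => (cont_clip (peak n w))%:E).
Proof.
apply/measurable_EFinP; apply: (measurableT_comp measurable_cont_clip).
exact: (measurable_fun_info (peak_info (leqnn n))).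
Qed.

Lemma future_split n : future n =
  (\int[P]_(w in stops n.+1) (next_gain (peak n w) (X n.+1 w))%:E +
   \int[P]_(w in waiting n.+1) (next_gain (peak n w) (X n.+1 w))%:E)%E.
Proof.
rewrite /future waiting_next ge0_integral_setU//.
- exact: stops_measurable.
- exact: waiting_measurable.
- exact: measurable_funTS.
- by move=> w _; rewrite lee_fin next_gain_ge0.
- by apply/disj_setPS => w [st [_ /(_ n.+1 (leqnn _))]].
Qed.

(** next_step integrates out X_(n+1), by mean_next_gain. *)
Lemma futureE n : (1 <= n)%N ->
  future n = (\int[P]_(w in waiting n) (cont_clip (peak n w))%:E)%E.
Proof.
move=> n1; apply: (@next_step _ _ n (waiting n) (peak n) [set z | 0 <= z <= 1]
  (fun zv => next_gain zv.1 zv.2) cont_clip n1 (waiting_info n1)).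
- by move=> w [].
- exact: info_measurable_fun (peak_info (leqnn n)).
- exact: measurable_next_gain.
- exact: measurable_cont_clip.
- by apply: filterS in_unit_ae => w; exact: peak_unit.
- by move=> z y _ _; exact: next_gain_ge0.
- by move=> z; exact: mean_next_gain.
Qed.

Lemma future_ge0 n : (0 <= future n)%E.
Proof. by apply: integral_ge0 => w _; rewrite lee_fin next_gain_ge0. Qed.

Lemma future_le n :
  (future n.+1 <= (q / (1 - q) * (2 * ln (1 - q)^-1) * q ^+ n)%:E)%E.
Proof.
rewrite futureE//; have := @alive_bound 1 n (q / (1 - q) * (2 * ln (1 - q)^-1))
  (waiting n.+1) (fun w => cont_clip (peak n.+1 w)).
rewrite expr0 mulr1; apply => //.
- exact: waiting_measurable.
- by move=> w []; rewrite add1n.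
- by apply/measurable_EFinP; exact: m_cont.
- move=> w; rewrite cont_clip_ge0/=; apply: cont_value_le => //.
  by rewrite clip_le1 andbT /clip le_min ler01 andbT; apply: le_trans (peak_ge_start n.+1 w);
    case/andP: start01.
Qed.

(** The supermartingale inequality for the candidate value. *)
Lemma stopped_gain_le n : (stopped_gain n.+1 + future n.+1 <= future n)%E.
Proof.
rewrite (future_split n) (@futureE n.+1)//; apply: leeD; apply: ae_ge0_le_integral.
- exact: stops_measurable.
- by move=> w _; rewrite lee_fin stop_clip_ge0.
- exact: measurable_funTS.
- by move=> w _; rewrite lee_fin next_gain_ge0.
- exact: measurable_funTS.
- apply: filterS in_unit_ae => w Uw st; rewrite lee_fin stop_le_next_gain//.
  by have [_ /(_ _ _ st)[]] := adm.
- exact: waiting_measurable.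
- by move=> w _; rewrite lee_fin cont_clip_ge0.
- exact: measurable_funTS.
- by move=> w _; rewrite lee_fin next_gain_ge0.
- exact: measurable_funTS.
- by apply: filterS in_unit_ae => w Uw _; rewrite lee_fin cont_le_next_gain.
Qed.

(** A rule that stops exactly at the relatively best observations above the threshold
    makes the inequality of stopped_gain_le an equality. *)
Lemma stopped_gain_eq n :
  (forall w, in_unit w -> sigma w = Some n.+1 -> thr <= X n.+1 w) ->
  (forall w, in_unit w -> waiting n.+1 w ->
     ~ (relatively_best X n.+1 w /\ thr <= X n.+1 w)) ->
  (stopped_gain n.+1 + future n.+1 = future n)%E.
Proof.
move=> stop_thr wait_thr.
rewrite (future_split n) (@futureE n.+1)//; congr (_ + _)%E; apply: ae_eq_integral.
- exact: stops_measurable.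
- exact: measurable_funTS.
- exact: measurable_funTS.
- apply: filterS in_unit_ae => w Uw st; rewrite stop_eq_next_gain//.
    by have [_ /(_ _ _ st)[]] := adm.
  exact: stop_thr.
- exact: waiting_measurable.
- exact: measurable_funTS.
- exact: measurable_funTS.
- by apply: filterS in_unit_ae => w Uw wt; rewrite cont_eq_next_gain//; exact: wait_thr.
Qed.

(** The payoff is split according to the stage at which the rule stops, and
    integral_duration replaces the duration by w on each piece. *)
Lemma expected_payoff :
  (\int[P]_w (payoff X N sigma w)%:E = \sum_(0 <= k <oo) stopped_gain k.+1)%E.
Proof.
have [st best] := adm.
have dur k := @integral_duration k.+1 (stops k.+1) isT (st k.+1).
have sub k : stops k.+1 `<=` [set w | (k.+1 <= N w)%N /\ relatively_best X k.+1 w].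
  by move=> w /best[/andP[_ kN] bk].
pose F k := (fun w => (duration X N k.+1 w)%:E) \_ (stops k.+1).
have dur_ge0 k w : stops k.+1 w -> (0 <= (duration X N k.+1 w)%:E :> \bar R)%E.
  move=> /sub[kN bk]; rewrite duration_series//.
  by apply: nneseries_ge0 => j _ _; rewrite lee_fin.
have FE w : (payoff X N sigma w)%:E = (\sum_(0 <= k <oo) F k w)%E.
  rewrite /payoff; case E : (sigma w) => [[|n]|].
  - by have [] := best w _ E.
  - rewrite (@nneseries_finite _ _ n.+1); last first.
      move=> k nk; rewrite /F patchE memNset// /stops/= E => -[e].
      by move: nk; rewrite e ltnn.
    rewrite big_nat_recr//= big_nat_cond big1 ?add0e; last first.
      move=> k; rewrite andbT => /= kn; rewrite /F patchE memNset// /stops/= E => -[e].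
      by move: kn; rewrite e ltnn.
    by rewrite /F patchE mem_set.
  - rewrite (@nneseries_finite _ _ 0); first by rewrite big_nil.
    by move=> k _; rewrite /F patchE memNset// /stops/= E.
have mF k : measurable_fun setT (F k).
  apply/(measurable_restrictT _ (stops_measurable k.+1)).
  by have [] := dur k (sub k).
have F0 k w : (0 <= F k w)%E.
  by rewrite /F patchE; case: ifP => // /[1!inE]; exact: dur_ge0.
rewrite (eq_integral (fun w => \sum_(0 <= k <oo) F k w)%E); last by move=> w _; exact: FE.
rewrite integral_nneseries//; apply: eq_eseriesr => k _.
by rewrite /F -integral_mkcond; have [_ ->] := dur k (sub k).
Qed.

Lemma waiting0 : waiting 0 = setT.
Proof.
apply/seteqP; split => // w _; split=> // i /=; rewrite leqn0 => /eqP -> st.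
by have [_ /(_ _ _ st)[]] := adm.
Qed.

Lemma expected_payoff_le :
  (\int[P]_w (payoff X N sigma w)%:E <=
   \int[P]_(w in alive 1) (next_gain (peak 0 w) (X 1%N w))%:E)%E.
Proof.
rewrite expected_payoff; have -> : alive 1 = waiting 0 `&` alive 1 by rewrite waiting0 setTI.
apply: (telescope_le (a := future)) => k; first exact: future_ge0.
- by apply: integral_ge0 => w _; rewrite lee_fin stop_clip_ge0.
- exact: stopped_gain_le.
Qed.

Lemma expected_payoff_eq :
  (forall n w, in_unit w -> sigma w = Some n.+1 -> thr <= X n.+1 w) ->
  (forall n w, in_unit w -> waiting n.+1 w ->
     ~ (relatively_best X n.+1 w /\ thr <= X n.+1 w)) ->
  (\int[P]_w (payoff X N sigma w)%:E =
   \int[P]_(w in alive 1) (next_gain (peak 0 w) (X 1%N w))%:E)%E.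
Proof.
move=> stop_thr wait_thr.
have step k := stopped_gain_eq (stop_thr k) (wait_thr k).
have gain0 k : (0 <= stopped_gain k)%E.
  by apply: integral_ge0 => w _; rewrite lee_fin stop_clip_ge0.
rewrite expected_payoff; have -> : alive 1 = waiting 0 `&` alive 1 by rewrite waiting0 setTI.
(* The geometric bound of future_le starts at stage 1, so the first term is split
   off. *)
rewrite nneseries_recl// -/(future 0) -(step 0%N); congr (_ + _)%E.
rewrite -(nneseries_addn 1)//; under eq_eseriesr do rewrite addn1.
apply: (telescope_eq (a := fun k => future k.+1) hq) => k //.
- exact: future_ge0.
- exact: future_le.
Qed.

End rule.

Section threshold_set.
(* The one-step-look-ahead set and the half-line above the threshold differ outside
   [0, 1], so the rule is studied for any set that agrees with them on [0, 1]. *)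
Context (S : set (nat * R)).
Context (S_thr : forall (n : nat) (x : R),
  (1 <= n)%N -> 0 <= x <= 1 -> S (n, x) <-> thr <= x).
Context (mS : forall n, (1 <= n)%N -> measurable [set x | S (n, x)]).

Let good n w := relatively_best X n w && `[< S (n, X n w) >].

Lemma first_best_inP n w : first_best_in X N S w = Some n <->
  [/\ (1 <= n <= N w)%N, good n w &
      forall m, (1 <= m < n)%N -> ~~ good m w].
Proof. by rewrite /first_best_in ohead_filter_iotaP add1n ltnS. Qed.

Lemma first_best_in_before n w : (1 <= n <= N w)%N -> good n w ->
  exists2 i, (i <= n)%N & first_best_in X N S w = Some i.
Proof.
move=> nN gn; case E : (first_best_in X N S w) => [i|].
  exists i => //; have [/andP[i1 _] _ ng] := (first_best_inP i w).1 E.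
  by rewrite leqNgt; apply/negP => ni; have := ng n; rewrite gn; case/andP: nN => -> _ /=; rewrite ni => /(_ isT).
have : n \in [seq m <- iota 1 (N w) | good m w].
  by rewrite mem_filter gn mem_iota add1n ltnS.
move: E; rewrite -[first_best_in X N S w]/(ohead [seq m <- iota 1 (N w) | good m w]).
by case: [seq m <- iota 1 (N w) | good m w].
Qed.

Lemma first_best_in_admissible : admissible X N (first_best_in X N S).
Proof.
split=> [n|w n]; last by move=> /first_best_inP[nN /andP[bn _] _].
have [->|n1] := posnP n.
  rewrite (_ : [set w | _] = set0); first exact: (@measurable0 _ (state_space 0)).
  by apply/seteqP; split => w //= /first_best_inP[].
have goodE m : [set w | good m w] =
    [set w | relatively_best X m w] `&` X m @^-1` [set x | S (m, x)].
  apply/seteqP; split=> w; first by move=> /andP[? /asboolP].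
  by move=> [bm Sm]; apply/andP; split => //; exact/asboolP.
have igood m : (1 <= m <= n)%N -> info X N n [set w | good m w].
  move=> mn; rewrite goodE; apply: (@measurableI _ (state_space n)).
    exact: relatively_best_info.
  by apply: info_preimage => //; apply: mS; case/andP: mn.
rewrite (_ : [set w | _] = alive n `&` [set w | good n w] `&`
    \bigcap_(m in [set m | (1 <= m < n)%N]) ~` [set w | good m w]).
  apply: (@measurableI _ (state_space n)).
    apply: (@measurableI _ (state_space n)); last by apply: igood; rewrite n1 leqnn.
    by apply: info_alive; rewrite n1 leqnn.
  apply: (@measurable_bigcap_nat _ (state_space n)) => m /= /andP[m1 mn].
  by apply: (@measurableC _ (state_space n)); apply: igood; rewrite m1 ltnW.
apply/seteqP; split => w.
  move=> /first_best_inP[/andP[_ nN] gn ng]; split; first by [].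
  by move=> m /= /ng /negP.
move=> [[nN gn] ng]; apply/first_best_inP; split=> //; first by rewrite n1.
by move=> m /ng /negP.
Qed.

(** Both bounds refer to the same constant, the mean of next_gain at the first
    observation. *)
Lemma first_best_in_optimal : optimal X N (first_best_in X N S).
Proof.
have adm := first_best_in_admissible; split=> // sigma sadm.
rewrite (expected_payoff_eq adm); first exact: expected_payoff_le.
  move=> n w Uw /first_best_inP[_ /andP[_ /asboolP]].
  by rewrite S_thr//; exact: Uw.
move=> n w Uw [an nst] [bn thrX].
have [//||i i_n st] := @first_best_in_before n.+1 w; last exact: nst st.
by rewrite /good bn/=; apply/asboolP/S_thr => //; exact: Uw.
Qed.

(** Almost surely all observations lie in [0, 1], where membership in such a set only
    means to be above the threshold. *)
Lemma first_best_in_unit (S' : set (nat * R)) w : in_unit w ->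
  (forall (n : nat) (x : R), (1 <= n)%N -> 0 <= x <= 1 ->
     S' (n, x) <-> thr <= x) ->
  first_best_in X N S w = first_best_in X N S' w.
Proof.
move=> Uw S'_thr; rewrite /first_best_in; congr ohead.
apply: eq_in_filter => n; rewrite mem_iota => /andP[n1 _]; congr (_ && _).
by apply/asbool_equiv_eq; rewrite S_thr ?S'_thr//; exact: Uw.
Qed.

Lemma first_best_in_first w : in_unit w -> (1 <= N w)%N -> thr <= 0 ->
  first_best_in X N S w = Some 1%N.
Proof.
move=> Uw N1 thr0; apply/first_best_inP; split; first by rewrite N1.
  apply/andP; split; last first.
    have /andP[X0 X1] := Uw 1%N isT.
    by apply/asboolP/S_thr; rewrite ?X0//; exact: le_trans X0.
  by apply/relatively_bestP => i; rewrite -eqn_leq => /eqP <-.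
by move=> [|[]].
Qed.

End threshold_set.

Lemma measurable_osla n : (1 <= n)%N -> measurable [set x | osla_set q (n, x)].
Proof.
move=> n1; rewrite (_ : [set x | _] = `[0, 1]%classic `&` `[thr, +oo[%classic).
  exact: measurableI.
apply/seteqP; split => x /=.
  move=> Sx; have x01 : 0 <= x <= 1 by case: Sx.
  by rewrite !in_itv/= x01 andbT; split => //; rewrite -(osla_setE hq mu1 mu_root n1 x01).
by rewrite !in_itv/= andbT => -[x01 thrx]; apply/(osla_setE hq mu1 mu_root).
Qed.

Lemma threshold_le0 : mu^-1 <= 1 - q -> thr <= 0.
Proof.
move=> mup; rewrite /threshold (_ : 1 - q - 1 = - q); last ring.
rewrite invrN mulrN oppr_le0 mulr_ge0 ?invr_ge0 ?(ltW q0)// subr_ge0.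
by rewrite -ler_pdivrMl ?mulr1// (lt_trans _ mu1).
Qed.

End optimality.

End observations.
(** * The one-step-look-ahead rule *)

Theorem mainTheorem2 (R : realType) (d : measure_display)
    (T : measurableType d) (P : probability T R)
    (X : nat -> {RV P >-> R}) (N : {RV P >-> nat}) (p q : R)
    (hp : 0 < p < 1) (hq : q = 1 - p)
    (X_unif : forall (i : nat) (A : set R), (1 <= i)%N -> measurable A ->
       distribution P (X i) A = uniform_prob (@ltr01 R) A)
    (X_indep : mutually_independent X)
    (N_indep : independent_of_seq X N)
    (N_geom : forall k : nat, (1 <= k)%N ->
       P (N @^-1` [set k]) = (p * q ^+ k.-1)%:E) :
  is_stopping_value X N (stop_value q) /\
  optimal X N (first_best_in X N (osla_set q)) /\
  exists mu : R,
    [/\ 1 < mu,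
        mu ^+ 2 * expR (2 / mu) = expR 3,
        forall nu : R, 1 < nu -> nu ^+ 2 * expR (2 / nu) = expR 3 -> nu = mu,
        {ae P, forall w, first_best_in X N (osla_set q) w =
           first_best_in X N (value_at_least ((mu * p - 1) / (p - 1))) w} &
        mu^-1 <= p ->
        {ae P, forall w,
           first_best_in X N (osla_set q) w =
             first_best_in X N (value_at_least 0) w /\
           first_best_in X N (osla_set q) w = Some 1%N}].
Proof.
have pE : p = 1 - q by rewrite hq; ring.
have q01 : 0 < q < 1 by rewrite hq; lra.
rewrite {}pE in N_geom *.
have [mu [mu1 mu_root]] := crit_root R.
have mu0 : 0 < mu by lra.
have osla_thr n x := @osla_setE _ q q01 mu mu1 mu_root n x.
have in_unit_as := in_unit_ae X_unif.
split; first exact: stop_value_correct.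
split.
  apply: (first_best_in_optimal q01 X_unif X_indep N_indep N_geom mu1 mu_root) => //.
  by move=> n; exact: (measurable_osla q01 mu1 mu_root).
exists mu; split=> //.
- exact/crit_equation.
- move=> nu nu1 /crit_equation nu_root.
  have nu0 : 0 < nu by lra.
  have [lt|gt|//] := ltgtP nu mu.
    by have := crit_lt (ltW nu1) lt; rewrite mu_root nu_root// ltxx.
  by have := crit_lt (ltW mu1) gt; rewrite mu_root nu_root// ltxx.
- apply: filterS in_unit_as => w Uw.
  by apply: (first_best_in_unit N osla_thr Uw) => n x _ _; exact: iff_refl.
- move=> mup; have thr0 := threshold_le0 q01 mu1 mup.
  have alive1 : {ae P, forall w, (1 <= N w)%N}.
    exists (~` alive N 1); split.
    + by apply: measurableC; exact: measurable_alive.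
    + rewrite probability_setC; last exact: measurable_alive.
      by rewrite (alive_prob q01 N_geom)// expr0 subee.
    + by [].
  apply: filterS2 in_unit_as alive1 => w Uw N1.
  rewrite (first_best_in_first osla_thr)//; split=> //; apply/esym/first_best_inP.
  split; first by rewrite N1.
  + apply/andP; split; last by apply/asboolP; have /andP[] := Uw 1%N isT.
    by apply/relatively_bestP => i; rewrite -eqn_leq => /eqP <-.
  + by move=> [|[]].
Qed.
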